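(* Let $\mu_1,\mu_2,\mu_3>-1/2$, let $N$ be a non-negative integer and let $\mu=(-1)^N(N+1+\mu_1+\mu_2+\mu_3)$. Let $\mathcal{Y}_K^N(\theta,\phi)$ and $\mathcal{Z}_S^N(\vartheta,\varphi)$, $K,S=0,\ldots,N$, be the two families of functions on $S^2$ defined in the context; they form orthonormal bases for the same space, and let $R^{\mu_1,\mu_2,\mu_3}_{S,K;N}$ be the real coefficients defined by $$\mathcal{Z}_S^N(\vartheta,\varphi)=\sum_{K=0}^NR^{\mu_1,\mu_2,\mu_3}_{S,K;N}\,\mathcal{Y}_K^N(\theta,\phi)$$ (both sides evaluated at the same point of $S^2$). Then for all $0\le S,K\le N$ $$R^{\mu_1,\mu_2,\mu_3}_{S,K;N}=\sqrt{\frac{w_{S;N}}{u_1u_2\cdots u_K}}\;B_K(x_S;\rho_1,\rho_2,r_1,r_2),$$ where $B_K$ are the Bannai--Ito polynomials with parameters $$\rho_1=\frac{\mu_2+\mu_3}{2},\quad\rho_2=\frac{\mu_1+\mu}{2},\quad r_1=\frac{\mu_3-\mu_2}{2},\quad r_2=\frac{\mu-\mu_1}{2},$$ $$x_S=\tfrac12\left[(-1)^S(S+\mu_2+\mu_3+1/2)-1/2\right],$$ $u_n=A_{n-1}C_n$ with $A_n,C_n$ the recurrence coefficients given in the context, and, writing $S=2\ell+\nu$ with $\nu\in\{0,1\}$, $$w_{S;N}=\frac{1}{h_N}\,\frac{(-1)^\nu(\rho_1-r_1+1/2;\rho_1-r_2+1/2)_{\ell+\nu}\,(\rho_1+\rho_2+1;2\rho_1+1)_\ell}{(\rho_1+r_1+1/2;\rho_1+r_2+1/2)_{\ell+\nu}\,(1;\rho_1-\rho_2+1)_\ell},$$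 $$h_N=\begin{cases}\frac{(2\rho_1+1;\,r_1-\rho_2+1/2)_{N/2}}{(\rho_1-\rho_2+1;\,\rho_1+r_1+1/2)_{N/2}},&N\text{ even},\\[1mm]\frac{(2\rho_1+1;\,r_1+r_2)_{(N+1)/2}}{(\rho_1+r_1+1/2;\,\rho_1+r_2+1/2)_{(N+1)/2}},&N\text{ odd}.\end{cases}$$
   Context: Notation: $(a)_n=a(a+1)\cdots(a+n-1)$ and $(a_1;a_2)_n=(a_1)_n(a_2)_n$. The product $u_1u_2\cdots u_K$ is $1$ for $K=0$. Bannai--Ito polynomials $B_n(x)=B_n(x;\rho_1,\rho_2,r_1,r_2)$: defined by $B_{-1}=0$, $B_0=1$ and $$xB_n(x)=B_{n+1}(x)+(\rho_1-A_n-C_n)B_n(x)+A_{n-1}C_nB_{n-1}(x),$$ $$A_n=\begin{cases}\frac{(n+2\rho_1-2r_1+1)(n+2\rho_1-2r_2+1)}{4(n+\rho_1+\rho_2-r_1-r_2+1)},&n\text{ even},\\[1mm]\frac{(n+2\rho_1+2\rho_2-2r_1-2r_2+1)(n+2\rho_1+2\rho_2+1)}{4(n+\rho_1+\rho_2-r_1-r_2+1)},&n\text{ odd},\end{cases}$$ $$C_n=\begin{cases}-\frac{n(n-2r_1-2r_2)}{4(n+\rho_1+\rho_2-r_1-r_2)},&n\text{ even},\\[1mm]-\frac{(n+2\rho_2-2r_2)(n+2\rho_2-2r_1)}{4(n+\rho_1+\rho_2-r_1-r_2)},&n\text{ odd},\end{cases}$$ with $C_0=0$. Functions $\mathcal{Y}_K^N$: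 $P_n^{(\alpha,\beta)}(x)$ denotes the standard Jacobi polynomial, with $P_n^{(\alpha,\beta)}=0$ for $n<0$; any factor raised to the power $0$ is read as $1$. Write $K=2k+p$ with $p\in\{0,1\}$, $k$ a non-negative integer. Define $$\mathcal{F}_K^{(+)}(\phi)=\zeta_K^{(+)}\Big\{\Big[\tfrac{k+1}{k+\mu_1+\mu_2+1}\Big]^{p/2}P_{k+p}^{(\mu_2-1/2,\mu_1-1/2)}(\cos2\phi)-(-1)^p\Big[\tfrac{k+\mu_1+\mu_2+1}{k+1}\Big]^{p/2}\cos\phi\sin\phi\,P_{k+p-1}^{(\mu_2+1/2,\mu_1+1/2)}(\cos2\phi)\Big\},$$ $$\mathcal{F}_K^{(-)}(\phi)=\zeta_K^{(-)}\Big\{\Big[\tfrac{k+\mu_1+1/2}{k+\mu_2+1/2}\Big]^{p/2}\sin\phi\,P_k^{(\mu_2+1/2,\mu_1-1/2)}(\cos2\phi)+(-1)^p\Big[\tfrac{k+\mu_2+1/2}{k+\mu_1+1/2}\Big]^{p/2}\cos\phi\,P_k^{(\mu_2-1/2,\mu_1+1/2)}(\cos2\phi)\Big\},$$ $$\zeta_K^{(+)}=\sqrt{\frac{(k+p)!\,\Gamma(k+\mu_1+\mu_2+1+p)}{2\,\Gamma(k+\mu_1+1/2+p)\Gamma(k+\mu_2+1/2+p)}},\qquad \zeta_K^{(-)}=\sqrt{\frac{k!\,\Gamma(k+\mu_1+\mu_2+1)}{2\,\Gamma(k+\mu_1+1/2)\Gamma(k+\mu_2+1/2)}}.$$ For $N=2n$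 and $K=2k+p$: $$\mathcal{Y}_K^N(\theta,\phi)=\sqrt{\frac{(n-k-p)!\,\Gamma(n+k+\mu_1+\mu_2+\mu_3+3/2)}{\Gamma(n+k+\mu_1+\mu_2+1)\Gamma(n-k+\mu_3+1/2-p)}}\Big\{\Big[\tfrac{n-k+\mu_3-1/2}{n+k+\mu_1+\mu_2+1}\Big]^{p/2}\sin^{2k+2p}\theta\,P_{n-k-p}^{(2k+2p+\mu_1+\mu_2,\mu_3-1/2)}(\cos2\theta)\,\mathcal{F}_K^{(+)}(\phi)$$ $$\qquad+\Big[\tfrac{n+k+\mu_1+\mu_2+1}{n-k+\mu_3-1/2}\Big]^{p/2}\cos\theta\sin^{2k+1}\theta\,P_{n-k-1}^{(2k+1+\mu_1+\mu_2,\mu_3+1/2)}(\cos2\theta)\,\mathcal{F}_K^{(-)}(\phi)\Big\}.$$ For $N=2n+1$ and $K=2k+p$: $$\mathcal{Y}_K^N(\theta,\phi)=(-1)^K\sqrt{\frac{(n-k)!\,\Gamma(n+k+\mu_1+\mu_2+\mu_3+3/2+p)}{\Gamma(n-k+\mu_3+1/2)\Gamma(n+k+\mu_1+\mu_2+1+p)}}\Big\{\Big[\tfrac{n+k+\mu_1+\mu_2+1}{n-k+\mu_3+1/2}\Big]^{(1-p)/2}\cos\theta\sin^{2k+2p}\theta\,P_{n-k-p}^{(2k+2p+\mu_1+\mu_2,\mu_3+1/2)}(\cos2\theta)\,\mathcal{F}_K^{(+)}(\phi)$$ $$\qquad-\Big[\tfrac{n-k+\mu_3+1/2}{n+k+\mu_1+\mu_2+1}\Big]^{(1-p)/2}\sin^{2k+1}\theta\,P_{n-k}^{(2k+1+\mu_1+\mu_2,\mu_3-1/2)}(\cos2\theta)\,\mathcal{F}_K^{(-)}(\phi)\Big\}.$$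 They are functions on $S^2$ through the coordinates $x_1=\sin\theta\cos\phi$, $x_2=\sin\theta\sin\phi$, $x_3=\cos\theta$, and are orthonormal with respect to the measure $h(\theta,\phi)\sin\theta\,d\theta\,d\phi$ with $h=|x_1|^{2\mu_1}|x_2|^{2\mu_2}|x_3|^{2\mu_3}$. Functions $\mathcal{Z}_S^N$: use the alternative coordinates $x_1=\cos\vartheta$, $x_2=\sin\vartheta\cos\varphi$, $x_3=\sin\vartheta\sin\varphi$ on $S^2$. Writing $\mathcal{Y}_K^N(\theta,\phi;\mu_1,\mu_2,\mu_3)$ to display the parameters, $$\mathcal{Z}_S^N(\vartheta,\varphi)=\begin{cases}\mathcal{Y}_S^N(\pi-\vartheta,\varphi;\mu_2,\mu_3,\mu_1),&N\text{ even},\\ \mathcal{Y}_S^N(\vartheta,\varphi;\mu_2,\mu_3,\mu_1),&N\text{ odd},\end{cases}$$ where $\pi-\vartheta$ involves the number $\pi$.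
   Formalization: The printed formula has wrong signs (for N=1, all μ_i=0, R_{0,0}=-1/2 but it gives +1/2); here its right-hand side is multiplied by (-1)^{N/2} for N even and by (-1)^{(N-1)/2+S+1} for N odd. *)

(* Defs.v *)
From HB Require Import structures.
From mathcomp Require Import all_boot all_order all_algebra.
From mathcomp Require Import all_classical all_reals all_analysis.
Set Implicit Arguments.
Unset Strict Implicit.
Unset Printing Implicit Defensive.
Import Order.TTheory GRing.Theory Num.Theory.
Import numFieldNormedType.Exports.
Local Open Scope classical_set_scope.
Local Open Scope ring_scope.

Definition poch (R : realType) (a : R) (n : nat) : R := \prod_(i < n) (a + i%:R).

Definition poch2 (R : realType) (a b : R) (n : nat) : R := poch a n * poch b n.

(* Euler's integral; only used at positive arguments. *)
Definition Gamma (R : realType) (x : R) : R :=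
  \int[@lebesgue_measure R]_(t in `]0, +oo[) (t `^ (x - 1) * expR (- t)).

(* P_n^(a,b)(x) = (a+1)_n/n! * 2F1(-n, n+a+b+1; a+1; (1-x)/2), and 0 for n < 0.
   Only used for a > -1, where (a+1)_j never vanishes. *)
Definition jacobi (R : realType) (n : int) (a b x : R) : R :=
  if n is Posz m then
    poch (a + 1) m / m`!%:R *
    \sum_(j < m.+1) poch (- m%:R) j * poch (m%:R + a + b + 1) j
                    / (poch (a + 1) j * j`!%:R) * ((1 - x) / 2) ^+ j
  else 0.

(* Throughout, K = 2k + p with k = K./2 and p = odd K.  The powers [_]^(p/2) are
   [powR], which is 1 at exponent 0 for every base, including a negative one. *)

Definition zetap (R : realType) (mu1 mu2 : R) (K : nat) : R :=
  let k := K./2 in let p : nat := odd K in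
  Num.sqrt ((k + p)`!%:R * Gamma (k%:R + mu1 + mu2 + 1 + p%:R)
            / (2 * Gamma (k%:R + mu1 + 1 / 2 + p%:R)
                 * Gamma (k%:R + mu2 + 1 / 2 + p%:R))).

Definition zetam (R : realType) (mu1 mu2 : R) (K : nat) : R :=
  let k := K./2 in
  Num.sqrt (k`!%:R * Gamma (k%:R + mu1 + mu2 + 1)
            / (2 * Gamma (k%:R + mu1 + 1 / 2) * Gamma (k%:R + mu2 + 1 / 2))).

Definition Fp (R : realType) (mu1 mu2 : R) (K : nat) (phi : R) : R :=
  let k := K./2 in let p : nat := odd K in
  zetap mu1 mu2 K *
  (((k%:R + 1) / (k%:R + mu1 + mu2 + 1)) `^ (p%:R / 2)
     * jacobi (k%:Z + p%:Z) (mu2 - 1 / 2) (mu1 - 1 / 2) (cos (2 * phi))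
   - (-1) ^+ p * ((k%:R + mu1 + mu2 + 1) / (k%:R + 1)) `^ (p%:R / 2)
     * cos phi * sin phi
     * jacobi (k%:Z + p%:Z - 1) (mu2 + 1 / 2) (mu1 + 1 / 2) (cos (2 * phi))).

Definition Fm (R : realType) (mu1 mu2 : R) (K : nat) (phi : R) : R :=
  let k := K./2 in let p : nat := odd K in
  zetam mu1 mu2 K *
  (((k%:R + mu1 + 1 / 2) / (k%:R + mu2 + 1 / 2)) `^ (p%:R / 2)
     * sin phi * jacobi k%:Z (mu2 + 1 / 2) (mu1 - 1 / 2) (cos (2 * phi))
   + (-1) ^+ p * ((k%:R + mu2 + 1 / 2) / (k%:R + mu1 + 1 / 2)) `^ (p%:R / 2)
     * cos phi * jacobi k%:Z (mu2 - 1 / 2) (mu1 + 1 / 2) (cos (2 * phi))).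

(* Y_K^N for N = 2n; the nat subtraction under the factorial is exact if K <= N. *)
Definition Yeven (R : realType) (mu1 mu2 mu3 : R) (n K : nat) (theta phi : R) : R :=
  let k := K./2 in let p : nat := odd K in
  Num.sqrt ((n - k - p)`!%:R * Gamma (n%:R + k%:R + mu1 + mu2 + mu3 + 3 / 2)
            / (Gamma (n%:R + k%:R + mu1 + mu2 + 1)
               * Gamma (n%:R - k%:R + mu3 + 1 / 2 - p%:R))) *
  (((n%:R - k%:R + mu3 - 1 / 2) / (n%:R + k%:R + mu1 + mu2 + 1)) `^ (p%:R / 2)
     * sin theta ^+ (2 * k + 2 * p)
     * jacobi (n%:Z - k%:Z - p%:Z)
              (2 * k%:R + 2 * p%:R + mu1 + mu2) (mu3 - 1 / 2) (cos (2 * theta))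
     * Fp mu1 mu2 K phi
   + ((n%:R + k%:R + mu1 + mu2 + 1) / (n%:R - k%:R + mu3 - 1 / 2)) `^ (p%:R / 2)
     * cos theta * sin theta ^+ (2 * k + 1)
     * jacobi (n%:Z - k%:Z - 1)
              (2 * k%:R + 1 + mu1 + mu2) (mu3 + 1 / 2) (cos (2 * theta))
     * Fm mu1 mu2 K phi).

(* Y_K^N for N = 2n + 1. *)
Definition Yodd (R : realType) (mu1 mu2 mu3 : R) (n K : nat) (theta phi : R) : R :=
  let k := K./2 in let p : nat := odd K in
  (-1) ^+ K *
  Num.sqrt ((n - k)`!%:R * Gamma (n%:R + k%:R + mu1 + mu2 + mu3 + 3 / 2 + p%:R)
            / (Gamma (n%:R - k%:R + mu3 + 1 / 2)
               * Gamma (n%:R + k%:R + mu1 + mu2 + 1 + p%:R))) *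
  (((n%:R + k%:R + mu1 + mu2 + 1) / (n%:R - k%:R + mu3 + 1 / 2)) `^ ((1 - p%:R) / 2)
     * cos theta * sin theta ^+ (2 * k + 2 * p)
     * jacobi (n%:Z - k%:Z - p%:Z)
              (2 * k%:R + 2 * p%:R + mu1 + mu2) (mu3 + 1 / 2) (cos (2 * theta))
     * Fp mu1 mu2 K phi
   - ((n%:R - k%:R + mu3 + 1 / 2) / (n%:R + k%:R + mu1 + mu2 + 1)) `^ ((1 - p%:R) / 2)
     * sin theta ^+ (2 * k + 1)
     * jacobi (n%:Z - k%:Z)
              (2 * k%:R + 1 + mu1 + mu2) (mu3 - 1 / 2) (cos (2 * theta))
     * Fm mu1 mu2 K phi).

Definition Yfun (R : realType) (mu1 mu2 mu3 : R) (N K : nat) (theta phi : R) : R :=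
  if odd N then Yodd mu1 mu2 mu3 N./2 K theta phi
  else Yeven mu1 mu2 mu3 N./2 K theta phi.

Definition Zfun (R : realType) (mu1 mu2 mu3 : R) (N S : nat) (vtheta vphi : R) : R :=
  if odd N then Yfun mu2 mu3 mu1 N S vtheta vphi
  else Yfun mu2 mu3 mu1 N S (pi - vtheta) vphi.

Definition sphere_pt (R : realType) (theta phi : R) : R * R * R :=
  (sin theta * cos phi, sin theta * sin phi, cos theta).

Definition sphere_pt_alt (R : realType) (vtheta vphi : R) : R * R * R :=
  (cos vtheta, sin vtheta * cos vphi, sin vtheta * sin vphi).

Definition BI_A (R : realType) (rho1 rho2 r1 r2 : R) (n : nat) : R :=
  if odd n then
    (n%:R + 2 * rho1 + 2 * rho2 - 2 * r1 - 2 * r2 + 1) * (n%:R + 2 * rho1 + 2 * rho2 + 1)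
    / (4 * (n%:R + rho1 + rho2 - r1 - r2 + 1))
  else
    (n%:R + 2 * rho1 - 2 * r1 + 1) * (n%:R + 2 * rho1 - 2 * r2 + 1)
    / (4 * (n%:R + rho1 + rho2 - r1 - r2 + 1)).

(* At n = 0 this is 0, even when the denominator vanishes. *)
Definition BI_C (R : realType) (rho1 rho2 r1 r2 : R) (n : nat) : R :=
  if odd n then
    - ((n%:R + 2 * rho2 - 2 * r2) * (n%:R + 2 * rho2 - 2 * r1)
       / (4 * (n%:R + rho1 + rho2 - r1 - r2)))
  else
    - (n%:R * (n%:R - 2 * r1 - 2 * r2) / (4 * (n%:R + rho1 + rho2 - r1 - r2))).

(* u_n = A_{n-1} C_n; only meaningful for n >= 1. *)
Definition BI_u (R : realType) (rho1 rho2 r1 r2 : R) (n : nat) : R :=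
  BI_A rho1 rho2 r1 r2 n.-1 * BI_C rho1 rho2 r1 r2 n.

Fixpoint BI (R : realType) (rho1 rho2 r1 r2 : R) (n : nat) : {poly R} :=
  match n with
  | 0 => 1
  | m.+1 =>
      ('X - (rho1 - BI_A rho1 rho2 r1 r2 m - BI_C rho1 rho2 r1 r2 m)%:P)
        * BI rho1 rho2 r1 r2 m
      - (if m is l.+1 then
           (BI_A rho1 rho2 r1 r2 l * BI_C rho1 rho2 r1 r2 m) *: BI rho1 rho2 r1 r2 l
         else 0)
  end.

Definition h_norm (R : realType) (rho1 rho2 r1 r2 : R) (N : nat) : R :=
  if odd N then
    poch2 (2 * rho1 + 1) (r1 + r2) N.+1./2
    / poch2 (rho1 + r1 + 1 / 2) (rho1 + r2 + 1 / 2) N.+1./2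
  else
    poch2 (2 * rho1 + 1) (r1 - rho2 + 1 / 2) N./2
    / poch2 (rho1 - rho2 + 1) (rho1 + r1 + 1 / 2) N./2.

Definition w_weight (R : realType) (rho1 rho2 r1 r2 : R) (N S : nat) : R :=
  let l := S./2 in let nu : nat := odd S in
  1 / h_norm rho1 rho2 r1 r2 N *
  ((-1) ^+ nu * poch2 (rho1 - r1 + 1 / 2) (rho1 - r2 + 1 / 2) (l + nu)
     * poch2 (rho1 + rho2 + 1) (2 * rho1 + 1) l
   / (poch2 (rho1 + r1 + 1 / 2) (rho1 + r2 + 1 / 2) (l + nu)
      * poch2 1 (rho1 - rho2 + 1) l)).

(* The phase of Z_S^N relative to the Y_K^N: (-1)^n for N = 2n, and
   (-1)^(n+S+1) for N = 2n + 1.  The source's formula for the expansion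
   coefficients omits this factor, but with the normalisations above it is needed:
   for N = 1 and mu1 = mu2 = mu3 = 0, Y_0 = c (2 x3 - x1 - x2), Y_1 = c' (x2 - x1)
   and Z_0 = c (2 x1 - x2 - x3) with c, c' > 0, so the coefficient of Z_0 on Y_0 is
   -1/2, whereas sqrt(w_0) B_0(x_0) = sqrt(w_0) >= 0. *)
Definition Z_phase (R : realType) (N S : nat) : R := (-1) ^+ (uphalf N + N * S).

(* Main.v *)
Require Import Defs.
From HB Require Import structures.
From mathcomp Require Import all_boot all_order all_algebra.
From mathcomp Require Import all_classical all_reals all_analysis.
From mathcomp Require Import measurable_realfun archimedean zify ring lra.
Set Implicit Arguments.
Unset Strict Implicit.
Unset Printing Implicit Defensive.
Import Order.TTheory GRing.Theory Num.Theory.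
Import numFieldNormedType.Exports.
Local Open Scope ring_scope.

(* Both families are restricted to the great circle x1 = 0, with x2 = s = sin theta and
   x3 = c = cos theta.  There a function of degree N is determined by N + 1
   coefficients, Z_S is a multiple of F_S^(+) or F_S^(-), hence an eigenvector of a
   first-order Dunkl operator, and Y_K = s^K (l_K + O(s)) is a sum of two
   hypergeometric series in s^2.  The operator is tridiagonal on the Y_K, so its
   eigenvalue equation is a three-term recurrence for the coefficients R_{S,K}, the
   Bannai-Ito recurrence after the scaling by l_K.  Hence R_{S,K} l_K is a multiple
   of R_{S,0} l_0 B_K(x_S), and R_{S,0} l_0 = Z_S(0, 0, 1), since only Y_0 survives at
   s = 0.  It remains to compare the constants: the quotients l_{K+1}^2 / l_K^2 give
   u_{K+1}, and Z_S(0, 0, 1)^2 / l_0^2 satisfies the recurrence in S of the weight,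
   both by Gamma(x + 1) = x Gamma(x). *)

(** The circle [x1 = 0] is chosen because both coordinate systems simplify on it: it is
    [phi = pi / 2] for the Y_K, where [Fp] and [Fm] agree up to sign, and [vtheta = pi / 2] for the
    Z_S, where one of the two terms of Z_S drops out. No information is lost, since the restricted
    Y_K are triangular in powers of s with nonzero leading coefficients l_K. The special parameters
    enter through [rho1 - r1 = mu2] and [rho2 - r2 = mu1]: the denominators of [BI_A] at index n
    become [4 * (n + 1 + mu1 + mu2)], four times the lower parameter of a hypergeometric series,
    hence positive. The eigenvalue for Z_S is [2 * x S + 1 / 2]. The main obstacle is the square
    roots. Each constant is determined by its square, a quotient of Gamma values, together with its
    sign. The sign [(-1) ^+ K./2] of l_K is that of the product of the [lowc i], so it cancels in
    the scaling, while the sign of Z_S(0, 0, 1) is exactly [Z_phase]. Lemmas on constants take K and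
    D = N - K as variables, so that raising K with N fixed is the step from (K, D + 1) to (K + 1,
    D). *)

(** * The functional equation of the Gamma function *)

Section GammaFunction.
Local Open Scope classical_set_scope.
Local Open Scope ring_scope.
Variable R : realType.
Implicit Types x y t : R.
Local Notation leb := (@lebesgue_measure R).

Let gint y t := t `^ y * expR (- t).

Let gint_ge0 y t : 0 <= gint y t.
Proof. by rewrite mulr_ge0 ?powR_ge0 ?expR_ge0. Qed.

Let continuous_powR_gt0 y t : 0 < t -> {for t, continuous (fun u : R => u `^ y)}.
Proof.
move=> t0; have /derivable1_diffP/differentiable_continuous : derivable (fun u : R => u `^ y) t 1.
  by apply: derivable_powR; rewrite in_itv/= t0.
exact.
Qed.

Let measurable_gint y (D : set R) : measurable D -> measurable_fun D (gint y).
Proof.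
move=> mD; apply: measurable_funM; apply: measurable_funTS.
  exact: measurable_powR.
by apply: measurableT_comp => //; exact: measurable_expR.
Qed.

(** The shift to n + 2 keeps the interval nondegenerate for every n, as integration by parts
    requires. *)
Let box (n : nat) : set R := `[n.+2%:R^-1, n.+2%:R].

Let invn_gt0 n : 0 < n.+2%:R^-1 :> R.
Proof. by rewrite invr_gt0 ltr0n. Qed.

Let invn_lt n : n.+2%:R^-1 < n.+2%:R :> R.
Proof.
apply: (@lt_trans _ _ 1); last by rewrite ltr1n.
by rewrite invf_lt1 ?ltr0n// ltr1n.
Qed.

Let gamma_ibp y n : 0 < y ->
  (\int[leb]_(t in box n) (gint y t)%:E
   = (gint y n.+2%:R^-1 - gint y n.+2%:R)%:E
     + y%:E * \int[leb]_(t in box n) (gint (y - 1) t)%:E)%E.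
Proof.
move=> y0.
have cE : continuous (fun t : R => expR (- t)).
  by move=> u; apply: continuous_comp; [exact: opp_continuous|exact: continuous_expR].
have cP z : {in `[n.+2%:R^-1, n.+2%:R], forall t, {for t, continuous (fun t : R => t `^ z)}}.
  move=> t; rewrite in_itv/= => /andP[/(lt_le_trans (invn_gt0 _)) t0 _].
  exact: continuous_powR_gt0.
have cPw z : {within box n, continuous (fun t : R => t `^ z)}.
  apply: continuous_in_subspaceT => t; rewrite inE => tb; exact: cP.
have dP : derivable_oo_LRcontinuous (fun t : R => t `^ y) n.+2%:R^-1 n.+2%:R.
  split.
  - move=> t; rewrite in_itv/= => /andP[/(lt_trans (invn_gt0 _)) t0 _].
    by apply: derivable_powR; rewrite in_itv/= t0.
  - by apply: cvg_at_right_filter; apply: cP; rewrite in_itv/= lexx ltW.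
  - by apply: cvg_at_left_filter; apply: cP; rewrite in_itv/= lexx ltW.
have dE : derivable_oo_LRcontinuous (fun t : R => - expR (- t)) n.+2%:R^-1 n.+2%:R.
  split.
  - by move=> t _; exact: ex_derive.
  - by apply: cvg_at_right_filter; apply: cvgN; exact: cE.
  - by apply: cvg_at_left_filter; apply: cvgN; exact: cE.
have := @integration_by_parts R (fun t => t `^ y) (fun t => - expR (- t))
  (fun t => y * t `^ (y - 1)) (fun t => expR (- t)) _ _ (invn_lt n) _ dP _ _ dE.
move=> ->.
- rewrite -ge0_integralZl//=.
  + rewrite -integralN/=; last first.
      apply: fin_num_adde_defr.
      rewrite (_ : (\int[leb]_(x in _) _)%E = 0%E)//.
      apply: integral0_eq => t _.
      rewrite funeposE; apply/max_idPr; rewrite lee_fin mulrN oppr_le0.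
      by rewrite mulr_ge0 ?expR_ge0// mulr_ge0 ?powR_ge0// ltW.
    congr (_ + _)%E; first by congr (_%:E); rewrite /gint; ring.
    by apply: eq_integral => t _; rewrite mulrN opprK -mulrA.
  + exact: measurable_itv.
  + by apply/measurable_EFinP; apply: measurable_gint; exact: measurable_itv.
  + by move=> t _; rewrite lee_fin.
  + by rewrite lee_fin ltW.
- apply: continuous_in_subspaceT => t; rewrite inE => tb.
  by apply: cvgM; [exact: cvg_cst|exact: cP].
- by move=> t; rewrite in_itv/= => /andP[/(lt_trans (invn_gt0 _)) t0 _];
    apply: powR_derive1; rewrite in_itv/= t0.
- exact: continuous_subspaceT.
- move=> t _; rewrite derive1N; last exact: ex_derive.
  by rewrite derive1E derive_val /GRing.scale/=; ring.
Qed.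

Let box_nd : nondecreasing_seq box.
Proof.
move=> m n mn; rewrite subsetEset; apply: subset_itv; rewrite bnd_simp.
  by rewrite lef_pV2 ?posrE ?ltr0n// ler_nat !ltnS.
by rewrite ler_nat !ltnS.
Qed.

Let bigcup_box : \bigcup_n box n = `]0, +oo[%classic.
Proof.
apply/seteqP; split => t.
  by move=> [n _] /=; rewrite !in_itv/= andbT => /andP[/(lt_le_trans (invn_gt0 _))].
rewrite /= in_itv/= andbT => t0.
have [m tm] : exists m : nat, t <= m.+2%:R.
  exists (Num.truncn t).+1.
  by apply/ltW/(lt_trans (truncnS_gt _)); rewrite ltr_nat.
have [k tk] : exists k : nat, t^-1 <= k.+2%:R.
  exists (Num.truncn t^-1).+1.
  by apply/ltW/(lt_trans (truncnS_gt _)); rewrite ltr_nat.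
exists (m + k)%N => //; rewrite /box/= in_itv/=; apply/andP; split.
  rewrite -[t]invrK lef_pV2 ?posrE ?ltr0n ?invr_gt0//.
  by apply: (le_trans tk); rewrite ler_nat !ltnS leq_addl.
by apply: (le_trans tm); rewrite ler_nat !ltnS leq_addr.
Qed.

Let cvg_gamma_box y :
  (\int[leb]_(t in box n) (gint y t)%:E @[n --> \oo]
     --> \int[leb]_(t in `]0%R, +oo[) (gint y t)%:E)%E.
Proof.
rewrite -bigcup_box; apply: ge0_nondecreasing_set_cvg_integral.
- exact: box_nd.
- by move=> i; exact: measurable_itv.
- by move=> i; apply/measurable_EFinP; apply: measurable_gint; exact: measurable_itv.
- by move=> i t _; rewrite lee_fin.
Qed.

Let powR_le_expR y : 0 <= y ->
  exists2 C, 0 < C & forall t, 0 <= t -> t `^ y <= C * expR (t / 2).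
Proof.
move=> y0; set m := (Num.truncn y).+1.
have ym : y <= m%:R by apply/ltW/truncnS_gt.
have m0 : 0 < m%:R :> R by rewrite ltr0n.
exists (1 + (2 * m%:R) ^+ m).
  by rewrite ltr_wpDr// exprn_ge0// mulr_ge0.
move=> t t0; rewrite mulrDl mul1r.
have [t1|t1] := leP t 1.
  apply: (@le_trans _ _ 1).
    have [->|tn0] := eqVneq t 0.
      have [->|yn0] := eqVneq y 0; first by rewrite powRr0.
      by rewrite powR0.
    rewrite -[leRHS](powRr0 t); apply: ger_powR => //.
    by rewrite t1 lt_neqAle eq_sym tn0 t0.
  rewrite -[leLHS]addr0; apply: lerD.
    by rewrite -expR0 ler_expR divr_ge0.
  by rewrite mulr_ge0 ?expR_ge0// exprn_ge0// mulr_ge0.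
apply: (@le_trans _ _ ((2 * m%:R) ^+ m * expR (t / 2))); last first.
  by rewrite lerDr expR_ge0.
apply: (@le_trans _ _ (t `^ m%:R)); first by apply: ler_powR => //; exact: ltW.
rewrite powR_mulrn//.
(* With [q = t / (2 * m)], t^m is (2m)^m q^m, and q <= exp q bounds it by (2m)^m exp(t / 2). *)
have -> : t / 2 = m%:R * (t / (2 * m%:R)) by field; rewrite gt_eqF.
rewrite expRM_natl -exprMn.
rewrite ler_pXn2r ?nnegrE//.
rewrite -ler_pdivrMl ?mulr_gt0// mulrC.
by rewrite (le_trans _ (expR_ge1Dx _))// lerDr.
Qed.

Let gint_le y : 0 <= y ->
  exists2 C, 0 < C & forall t, 0 <= t -> gint y t <= C * expR (- (t / 2)).
Proof.
move=> /powR_le_expR[C C0 H]; exists C => // t t0.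
rewrite /gint (_ : - (t / 2) = t / 2 - t); last by field.
by rewrite expRD mulrA ler_pM2r ?expR_gt0//; exact: H.
Qed.

Let cvgy_nat2 : (n.+2%:R : R) @[n --> \oo] --> +oo%R.
Proof. by apply/cvgrnyP; have := cvg_addnr 2; under eq_fun do rewrite addn2. Qed.

Let cvg_gint_y y : 0 <= y -> gint y n.+2%:R @[n --> \oo] --> 0.
Proof.
move=> y0; have [C C0 H] := gint_le y0.
apply: (@squeeze_cvgr _ _ _ _ (fun=> 0) (fun n => C * expR (- (n.+2%:R / 2)))).
- by near=> n; rewrite gint_ge0 H.
- exact: cvg_cst.
- rewrite -[X in _ --> X](mulr0 C); apply: cvgMr.
  have c2 : expR (- (t / 2)) @[t --> +oo%R] --> (0 : R).
    by apply: (@cvg_comp _ _ _ (fun t => t / 2 : R) (fun t => expR (- t)) _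
      (pinfty_nbhs R)); [exact: gt0_cvgMly|exact: cvgr_expR].
  exact: (cvg_comp _ _ cvgy_nat2 c2).
Unshelve. all: by end_near. Qed.

Let cvg_gint_0 y : 0 < y -> gint y n.+2%:R^-1 @[n --> \oo] --> 0.
Proof.
move=> y0.
have c0 : n.+2%:R^-1 @[n --> \oo] --> (0 : R).
  by apply/gtr0_cvgV0; [near=> n|exact: cvgy_nat2].
have cr : n.+2%:R^-1 @[n --> \oo] --> (0 : R)^'+.
  move=> P /c0 H.
  have {H} H : \forall n \near \oo, 0 < n.+2%:R^-1 :> R -> P n.+2%:R^-1 := H.
  by apply: (filterS _ H) => n /=; apply; exact: invn_gt0.
apply: (@squeeze_cvgr _ _ _ _ (fun=> 0) (fun n => n.+2%:R^-1 `^ y)).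
- near=> n; rewrite gint_ge0/= /gint ler_piMr ?powR_ge0//.
- exact: cvg_cst.
- exact: (cvg_comp _ _ cr (powR_cvg0 y0)).
Unshelve. all: by end_near. Qed.

Let egamma y : \bar R := (\int[leb]_(t in `]0%R, +oo[) (gint (y - 1) t)%:E)%E.

(** Working in [\bar R] lets the boxes exhaust the half-line by monotone convergence before the
    integral is known to be finite; the boundary terms tend to 0. *)
Let egammaS y : 0 < y -> (egamma (y + 1) = y%:E * egamma y)%E.
Proof.
move=> y0; rewrite /egamma addrK.
have cl := @cvg_gamma_box y.
apply: (cvg_unique _ cl) => //=.
under eq_fun do rewrite gamma_ibp//.
rewrite -[X in nbhs X]add0e; apply: cvgeD.
- by apply: fin_num_adde_defr.
- apply: cvg_EFin; first by near=> n.
  rewrite [X in _ --> X](_ : _ = 0 - 0); last by rewrite subr0.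
  apply: cvgB; [exact: cvg_gint_0|apply: cvg_gint_y; exact: ltW].
- by apply: cvgeZl => //; exact: cvg_gamma_box.
Unshelve. all: by end_near. Qed.

Let egamma_fin1 y : 1 <= y -> (egamma y < +oo)%E.
Proof.
rewrite -subr_ge0 => /gint_le[C C0 H].
have mE : measurable_fun setT (fun t : R => C * expR (- (t / 2))).
  apply: measurable_funM => //; apply: measurableT_comp => //.
  by apply: measurableT_comp => //; exact: measurable_funM.
apply: (@le_lt_trans _ _ (\int[leb]_(t in `[0%R, +oo[) (C * expR (- (t / 2)))%:E)%E).
  apply: (@le_trans _ _ (\int[leb]_(t in `]0%R, +oo[) (C * expR (- (t / 2)))%:E)%E).
    apply: ge0_le_integral => //=.
    - by move=> t _; rewrite lee_fin.
    - by apply/measurable_EFinP; exact: measurable_gint.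
    - by apply/measurable_EFinP; exact: measurable_funTS.
    - by move=> t; rewrite /= in_itv/= andbT => t0; rewrite lee_fin H// ltW.
  apply: ge0_subset_integral => //.
  - by apply/measurable_EFinP; exact: measurable_funTS.
  - by move=> t _; rewrite lee_fin mulr_ge0 ?expR_ge0// ltW.
  - by apply: subset_itvr; rewrite bnd_simp.
have cE : continuous (fun t : R => expR (- (t / 2))).
  move=> u; apply: continuous_comp; last exact: continuous_expR.
  by apply: cvgN; apply: cvgM => //; exact: cvg_cst.
rewrite (@ge0_continuous_FTC2y _ _ (fun t => - (2 * C) * expR (- (t / 2))) _ 0) ?ltry//.
- by move=> t _; rewrite mulr_ge0 ?expR_ge0// ltW.
- apply: continuous_subspaceT => t; apply: cvgM; [exact: cvg_cst|exact: cE].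
- rewrite -[X in _ --> X](mulr0 (- (2 * C))); apply: cvgMr.
  apply: (@cvg_comp _ _ _ (fun t => t / 2 : R) (fun t => expR (- t)) _
    (pinfty_nbhs R)); last exact: cvgr_expR.
  by apply: gt0_cvgMly.
- by apply: cvg_at_right_filter; apply: cvgM; [exact: cvg_cst|exact: cE].
- move=> t _; rewrite derive1E derive_val.
  by rewrite /GRing.scale/=; field.
Qed.

(** For 0 < y < 1 the integrand is unbounded near 0, but an infinite value at y would make the value
    at y + 1 infinite by [egammaS]. *)
Let egamma_fin y : 0 < y -> (egamma y < +oo)%E.
Proof.
move=> y0; have : (egamma (y + 1) < +oo)%E by apply: egamma_fin1; rewrite lerDr ltW.
rewrite egammaS//.
by apply: contraTT; rewrite -!leNgt !leye_eq => /eqP ->; rewrite gt0_muley.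
Qed.

Let egamma_ge0 y : (0 <= egamma y)%E.
Proof. by apply: integral_ge0 => t _; rewrite lee_fin. Qed.

(** Finiteness matters here too, since [fine] sends +oo to 0. The lower bound comes from [1, 2],
    where 0 <= ln t <= 1. *)
Lemma Gamma_gt0 x : 0 < x -> 0 < Gamma x.
Proof.
move=> x0; suff : (0 < egamma x)%E.
  move=> e0; rewrite /Gamma /Rintegral; apply: fine_gt0; rewrite e0/=.
  exact: egamma_fin.
have lec t : t \in `[1, 2] -> expR (- (`|x - 1| + 2)) <= gint (x - 1) t.
  rewrite in_itv/= => /andP[t1 t2].
  have t0 : 0 < t by apply: lt_le_trans t1.
  rewrite /gint /powR gt_eqF// -expRD ler_expR.
  have l0 : 0 <= ln t by rewrite ln_ge0.
  have l1 : ln t <= 1.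
    have := @le_ln1Dx _ (t - 1); rewrite addrCA subrr addr0 => H.
    by apply: (le_trans (H _)); lra.
  have : - `|x - 1| <= (x - 1) * ln t.
    rewrite lerNl -mulNr; apply: (@le_trans _ _ (`|x - 1| * ln t)).
      by rewrite ler_wpM2r// -normrN ler_norm.
    by rewrite ler_piMr.
  lra.
apply: (@lt_le_trans _ _ (\int[leb]_(t in `[1%R, 2%R]) (expR (- (`|x - 1| + 2)))%:E)%E).
  rewrite integral_cst//= lebesgue_measure_itv/= lte_fin ltr1n/=.
  by rewrite -EFinB -EFinM lte_fin mulr_gt0 ?expR_gt0//; lra.
apply: (@le_trans _ _ (\int[leb]_(t in `[1%R, 2%R]) (gint (x - 1) t)%:E)%E).
  apply: ge0_le_integral => //=.
  - by apply/measurable_EFinP; exact: measurable_gint.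
apply: ge0_subset_integral => //=.
- by apply/measurable_EFinP; exact: measurable_gint.
- by move=> t _; rewrite lee_fin.
- by move=> t /=; rewrite !in_itv/= andbT => /andP[/(lt_le_trans ltr01)].
Qed.

Lemma GammaS x : 0 < x -> Gamma (x + 1) = x * Gamma x.
Proof.
move=> x0.
rewrite /Gamma /Rintegral -[LHS]/(fine (egamma (x + 1))) -[X in _ * X]/(fine (egamma x)).
by rewrite egammaS// fineM// ge0_fin_numE// egamma_fin.
Qed.

End GammaFunction.

(** * Hypergeometric coefficients and Jacobi polynomials *)

(* Closes the nonvanishing side conditions of [field] by positivity. *)
Ltac nonzero := repeat (apply/andP; split); try assumption;
  try (apply: lt0r_neq0; lra); try (apply: ltr0_neq0; lra).

Section Pochhammer.
Variable R : realType.
Implicit Types (a b c : R) (n j : nat).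

Lemma poch0 a : poch a 0 = 1.
Proof. by rewrite /poch big_ord0. Qed.

Lemma pochS a n : poch a n.+1 = poch a n * (a + n%:R).
Proof. by rewrite /poch big_ord_recr. Qed.

Lemma pochSl a n : poch a n.+1 = a * poch (a + 1) n.
Proof.
rewrite /poch big_ord_recl /= addr0; congr (_ * _).
by apply: eq_bigr => i _; rewrite /bump/= natrD addrA.
Qed.

Lemma poch_gt0 a n : 0 < a -> 0 < poch a n.
Proof. by move=> a0; apply: prodr_gt0 => i _; rewrite ltr_wpDr. Qed.

Lemma poch_neq0 a n : 0 < a -> poch a n != 0.
Proof. by move=> /(poch_gt0 n)/lt0r_neq0. Qed.

Lemma addrn_neq0 c n : 0 < c -> c + n%:R != 0.
Proof. by move=> c0; rewrite gt_eqF// ltr_wpDr. Qed.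

Lemma poch_shift c n : c * poch (c + 1) n = poch c n * (c + n%:R).
Proof. by rewrite -pochSl pochS. Qed.

Lemma pochN_eq0 m j : (m < j)%N -> poch (- m%:R : R) j = 0.
Proof. by move=> mj; rewrite /poch (bigD1 (Ordinal mj))//= addNr mul0r. Qed.

(** Reversal of the order of the factors. It serves for Jacobi values at -1 and for the weight,
    whose parameters contain -N. *)
Lemma poch_opp a n : poch (1 - a - n%:R) n = (-1) ^+ n * poch a n.
Proof.
elim: n a => [|n IH] a; first by rewrite !poch0 mulr1.
rewrite pochS pochSl exprS.
have -> : 1 - a - n.+1%:R = 1 - (a + 1) - n%:R by rewrite -natr1; ring.
rewrite IH; ring.
Qed.

Lemma fact_natr_neq0 n : n`!%:R != 0 :> R.
Proof. by rewrite pnatr_eq0 -lt0n fact_gt0. Qed.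

Lemma natrS_neq0 n : n.+1%:R != 0 :> R.
Proof. by rewrite pnatr_eq0. Qed.

(* The [j]-th coefficient of the series 2F1(a, b; c; v). *)
Definition hyp a b c j : R := poch a j * poch b j / (poch c j * j`!%:R).

Lemma hyp0 a b c : hyp a b c 0 = 1.
Proof. by rewrite /hyp !poch0 !mul1r invr1. Qed.

Lemma hypS a b c j : 0 < c ->
  hyp a b c j.+1 = hyp a b c j * ((a + j%:R) * (b + j%:R) / ((c + j%:R) * j.+1%:R)).
Proof.
move=> c0; rewrite /hyp !pochS factS natrM.
have := addrn_neq0 j c0; have := poch_neq0 j c0.
have := fact_natr_neq0 j; have := ler0n R j => h1 h2 h3 h4.
by field; nonzero.
Qed.

(** Coefficientwise form of (c + v d/dv) F(a, b; c + 1; v) = c F(a, b; c; v). *)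
Lemma hyp_shiftc a b c j : 0 < c -> c * hyp a b c j = (c + j%:R) * hyp a b (c + 1) j.
Proof.
move=> c0; rewrite /hyp.
have c1 : 0 < c + 1 by rewrite ltr_wpDr.
have h0 := fact_natr_neq0 j; have h1 := poch_neq0 j c0; have h2 := poch_neq0 j c1.
apply: (mulIf h1); apply: (mulIf h2).
transitivity ((c * poch (c + 1) j) * (poch a j * poch b j) / j`!%:R).
  by field; rewrite h0 h1.
rewrite poch_shift; by field; rewrite h0 h2.
Qed.

(** Coefficientwise form of c F'(a, b; c; v) = a b F(a + 1, b + 1; c + 1; v). *)
Lemma hyp_shift a b c j : 0 < c ->
  c * j.+1%:R * hyp a b c j.+1 = a * b * hyp (a + 1) (b + 1) (c + 1) j.
Proof.
move=> c0; rewrite /hyp !pochSl factS natrM.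
have c1 : 0 < c + 1 by rewrite ltr_wpDr.
have h0 := fact_natr_neq0 j; have h1 := ler0n R j; have h2 := poch_neq0 j c1.
by field; nonzero.
Qed.

(** The Chu-Vandermonde sum, by induction on m through a contiguous relation. *)
Lemma sum_hyp m b c : 0 < c ->
  \sum_(j < m.+1) hyp (- m%:R) b c j = poch (c - b) m / poch c m.
Proof.
elim: m b c => [|m IH] b c c0.
  by rewrite big_ord_recl big_ord0 hyp0 !poch0 addr0 divr1.
have c1 : 0 < c + 1 by rewrite ltr_wpDr.
(* F(-m-1, b; c; v) = F(-m, b; c; v) - (b / c) v F(-m, b + 1; c + 1; v), read off at v^(j+1). *)
have E j : hyp (- m.+1%:R) b c j.+1
    = hyp (- m%:R) b c j.+1 - b / c * hyp (- m%:R) (b + 1) (c + 1) j.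
  apply: (mulfI (lt0r_neq0 c0)); apply: (mulfI (natrS_neq0 j)).
  rewrite mulrA [_ * c]mulrC hyp_shift//.
  have -> : - m.+1%:R + 1 = - m%:R :> R by rewrite -natr1; ring.
  have := @hyp_shift (- m%:R) b c j c0.
  have -> : - m%:R + 1 = 1 - m%:R :> R by ring.
  move=> H.
  have -> : j.+1%:R * (c * (hyp (- m%:R) b c j.+1 - b / c * hyp (- m%:R) (b + 1) (c + 1) j))
    = (c * j.+1%:R * hyp (- m%:R) b c j.+1) - j.+1%:R * b * hyp (- m%:R) (b + 1) (c + 1) j.
    by field; rewrite gt_eqF.
  rewrite H.
  suff : m%:R * hyp (1 - m%:R) (b + 1) (c + 1) j = (m%:R - j%:R) * hyp (- m%:R) (b + 1) (c + 1) j.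
    move=> H2; have -> : - m%:R * b * hyp (1 - m%:R) (b + 1) (c + 1) j
      = - b * (m%:R * hyp (1 - m%:R) (b + 1) (c + 1) j) by ring.
    by rewrite H2 -!natr1; ring.
  rewrite /hyp; set b1 := b + 1; set c1' := c + 1.
  have := poch_shift (- m%:R) j.
  have -> : - m%:R + 1 = 1 - m%:R :> R by ring.
  move=> H3.
  transitivity (- (- m%:R * poch (1 - m%:R) j) * (poch b1 j / (poch c1' j * j`!%:R))).
    ring.
  rewrite H3; ring.
rewrite big_ord_recl /= hyp0.
under eq_bigr => j _ do rewrite /bump/= add1n E.
rewrite big_split/= addrA.
have -> : 1 + \sum_(i < m.+1) hyp (- m%:R) b c i.+1 = \sum_(i < m.+1) hyp (- m%:R) b c i.
  rewrite [RHS]big_ord_recl /= hyp0; congr (_ + _).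
  rewrite big_ord_recr /= [hyp _ _ _ m.+1]/hyp pochN_eq0// !mul0r addr0.
  by apply: eq_bigr.
rewrite IH// sumrN -mulr_sumr IH//.
have h1 := poch_neq0 m c0; have h2 := poch_neq0 m c1; have h3 := addrn_neq0 m c0.
have -> : c + 1 - (b + 1) = c - b by ring.
rewrite !pochS.
have -> : poch (c + 1) m = poch c m * (c + m%:R) / c.
  by rewrite -poch_shift; field; rewrite gt_eqF.
by field; rewrite h1 h3 (gt_eqF c0).
Qed.

End Pochhammer.

(** * Jacobi polynomials and their four shift relations *)

Section Jacobi.
Variable R : realType.
Implicit Types (a b c v : R) (n j k m : nat).

(* The Jacobi polynomial in the variable [v = (1 - x) / 2]. *)
Definition jacp (m : int) a b : {poly R} :=
  if m is Posz m then
    \poly_(j < m.+1) (poch (a + 1) m / m`!%:R * hyp (- m%:R) (m%:R + a + b + 1) (a + 1) j)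
  else 0.

Lemma jacobiE (m : int) a b x : jacobi m a b x = (jacp m a b).[(1 - x) / 2].
Proof.
case: m => m /=; last by rewrite horner0.
rewrite horner_poly mulr_sumr; apply: eq_bigr => j _.
by rewrite /hyp !mulrA.
Qed.

Lemma coef_jacp m a b j : (jacp m a b)`_j
  = poch (a + 1) m / m`!%:R * hyp (- m%:R) (m%:R + a + b + 1) (a + 1) j.
Proof.
rewrite /= coef_poly; case: ltnP => // mj.
by rewrite /hyp pochN_eq0// !mul0r mulr0.
Qed.

Lemma jacobi1 m a b : jacobi m a b 1 = poch (a + 1) m / m`!%:R.
Proof.
by rewrite jacobiE subrr mul0r horner_coef0 coef_jacp hyp0 mulr1.
Qed.

Lemma jacobiN1 m a b : -1 < a ->
  jacobi m a b (-1) = (-1) ^+ m * poch (b + 1) m / m`!%:R.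
Proof.
move=> a1; have c0 : 0 < a + 1 by lra.
rewrite jacobiE horner_poly.
have -> : (1 - -1) / 2 = 1 :> R by field.
under eq_bigr do rewrite expr1n mulr1.
rewrite -mulr_sumr sum_hyp//.
have -> : a + 1 - (m%:R + a + b + 1) = 1 - (b + 1) - m%:R by ring.
rewrite poch_opp; field.
by rewrite fact_natr_neq0 poch_neq0.
Qed.

Lemma jacp_deriv m a b : -1 < a ->
  (jacp m a b)^`() = - (m%:R + a + b + 1) *: jacp (m%:Z - 1) (a + 1) (b + 1).
Proof.
move=> a1; have c0 : 0 < a + 1 by lra.
apply/polyP => j; rewrite coef_deriv coefZ coef_jacp.
case: m => [|m].
  by rewrite coef0 mulr0 /hyp oppr0 pochSl !mul0r mulr0 mul0rn.
have -> : m.+1%:Z - 1 = m by rewrite intS addrAC subrr add0r.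
rewrite coef_jacp.
have := hyp_shift (- m.+1%:R) (m.+1%:R + a + b + 1) j c0.
have -> : - m.+1%:R + 1 = - m%:R :> R by rewrite -natr1; ring.
have -> : m.+1%:R + a + b + 1 + 1 = m%:R + (a + 1) + (b + 1) + 1 by rewrite -natr1; ring.
rewrite pochSl factS natrM => H.
have h0 := fact_natr_neq0 R m; have h1 := ler0n R m.
rewrite -[LHS]mulr_natl.
transitivity (poch (a + 1 + 1) m / (m.+1%:R * m`!%:R) *
  ((a + 1) * j.+1%:R * hyp (- m.+1%:R) (m.+1%:R + a + b + 1) (a + 1) j.+1)).
  by field; nonzero.
by rewrite H; field; nonzero.
Qed.

(** The backward shift: the derivative of v^(a+1) (1-v)^(b+1) Q is m v^a (1-v)^b P. For m = 0 both
    sides vanish, Q having degree index -1. *)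
Lemma jacp_dual_deriv m a b : -1 < a ->
  let Q := jacp (m%:Z - 1) (a + 1) (b + 1) in
  (a + 1) *: ((1 - 'X) * Q) - (b + 1) *: ('X * Q) + 'X * (1 - 'X) * Q^`()
  = m%:R *: jacp m a b.
Proof.
move=> a1; have c0 : 0 < a + 1 by lra.
have c1 : 0 < a + 1 + 1 by lra.
case: m => [|m].
  by rewrite /= !mulr0 !scaler0 subr0 scale0r deriv0 mulr0 addr0.
have -> : m.+1%:Z - 1 = m by rewrite intS addrAC subrr add0r.
move=> Q; rewrite {}/Q; set Q := jacp _ _ _.
have h0 := fact_natr_neq0 R m; have h1 := ler0n R m.
apply/polyP => j.
have -> : (a + 1) *: ((1 - 'X) * Q) - (b + 1) *: ('X * Q) + 'X * (1 - 'X) * Q^`()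
  = (a + 1) *: Q - (a + b + 2) *: (Q * 'X) + Q^`() * 'X - Q^`() * 'X * 'X.
  by rewrite -!mul_polyC !polyCD; ring.
rewrite !(coefD, coefN, coefZ, coefMX) coef_jacp.
case: j => [|j] /=.
  rewrite !mulr0 subr0 !addr0 oppr0 addr0 coef_jacp !hyp0 pochSl factS natrM.
  by field; nonzero.
have -> : (if j == 0%N then 0 else Q^`()`_j.-1) = j%:R * Q`_j.
  by case: j => [|j]; rewrite ?mul0r// coef_deriv mulr_natl.
rewrite coef_deriv.
have H := hyp_shift (- m.+1%:R) (m.+1%:R + a + b + 1) j c0.
have E1 : - m.+1%:R + 1 = - m%:R :> R by rewrite -natr1; ring.
have E2 : m.+1%:R + a + b + 1 + 1 = m%:R + (a + 1) + (b + 1) + 1 by rewrite -natr1; ring.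
rewrite E1 E2 in H.
rewrite !coef_jacp hypS//.
have h2 := ler0n R j.
have h3 := addrn_neq0 j c1; have h4 := lt0r_neq0 c0.
transitivity (m.+1%:R * poch (a + 1 + 1) m / (m.+1%:R * m`!%:R * j.+1%:R) *
  ((a + 1) * j.+1%:R * hyp (- m.+1%:R) (m.+1%:R + a + b + 1) (a + 1) j.+1)); last first.
  by rewrite pochSl factS natrM; field; nonzero.
rewrite H.
set h := hyp _ _ _ j.
by rewrite -mulr_natl -!natr1; field; nonzero.
Qed.

(** The derivative of v^(a+1) times the polynomial with parameters (a + 1, b), divided by v^a: one
    parameter falls, the other rises, and the degree is kept. *)
Lemma jacp_mixed_deriv k a b : -1 < a ->
  (a + 1) *: jacp k (a + 1) b + 'X * (jacp k (a + 1) b)^`()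
  = (k%:R + a + 1) *: jacp k a (b + 1).
Proof.
move=> a1; have c0 : 0 < a + 1 by lra.
apply/polyP => j.
rewrite [X in _ + X]mulrC !(coefD, coefZ, coefMX).
have -> : (if j == 0%N then 0 else ((jacp k (a + 1) b)^`())`_j.-1) = j%:R * (jacp k (a + 1) b)`_j.
  by case: j => [|j]; rewrite ?mul0r// coef_deriv mulr_natl.
rewrite !coef_jacp.
have -> : k%:R + (a + 1) + b + 1 = k%:R + a + (b + 1) + 1 by ring.
have := hyp_shiftc (- k%:R) (k%:R + a + (b + 1) + 1) j c0.
have := poch_shift (a + 1) k.
set h1 := hyp _ _ _ _; set h2 := hyp _ _ _ _ => H1 H2.
transitivity (poch (a + 1 + 1) k / k`!%:R * ((a + 1 + j%:R) * h2)); first ring.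
rewrite -H2.
transitivity ((a + 1) * poch (a + 1 + 1) k / k`!%:R * h1); first ring.
rewrite H1; ring.
Qed.

(** The inverse exchange of parameters, from the derivative of (1-v)^(b+1) times the polynomial with
    parameters (a, b + 1). *)
Lemma jacp_mixed_dual_deriv k a b : -1 < a ->
  (b + 1) *: jacp k a (b + 1) - (1 - 'X) * (jacp k a (b + 1))^`()
  = (k%:R + b + 1) *: jacp k (a + 1) b.
Proof.
move=> a1; have c0 : 0 < a + 1 by lra.
set Q := jacp k a (b + 1).
have -> : (b + 1) *: Q - (1 - 'X) * Q^`() = (b + 1) *: Q - Q^`() + Q^`() * 'X.
  by rewrite -!mul_polyC; ring.
apply/polyP => j; rewrite !(coefD, coefN, coefZ, coefMX).
have -> : (if j == 0%N then 0 else Q^`()`_j.-1) = j%:R * Q`_j.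
  by case: j => [|j]; rewrite ?mul0r// coef_deriv mulr_natl.
rewrite coef_deriv !coef_jacp hypS//.
have -> : k%:R + (a + 1) + b + 1 = k%:R + a + (b + 1) + 1 by ring.
have := hyp_shiftc (- k%:R) (k%:R + a + (b + 1) + 1) j c0.
have := poch_shift (a + 1) k.
set h1 := hyp _ _ _ _; set h2 := hyp _ _ _ _ => H1 H2.
have h3 := addrn_neq0 j c0; have h4 := fact_natr_neq0 R k; have h5 := natrS_neq0 R j.
have h6 := lt0r_neq0 c0.
have -> : h2 = (a + 1) * h1 / (a + 1 + j%:R) by rewrite H2; field.
have -> : poch (a + 1 + 1) k = poch (a + 1) k * (a + 1 + k%:R) / (a + 1).
  by rewrite -H1; field.
have h7 := ler0n R j.
by rewrite -mulr_natl; field; nonzero.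
Qed.

End Jacobi.

Arguments jacp : simpl never.
Arguments jacobi : simpl never.

(** * The tridiagonal action *)

Section Tridiagonal.
Variables (R : realType) (mu1 mu2 mu3 : R) (N : nat).
Hypotheses (hmu1 : - (1 / 2) < mu1) (hmu2 : - (1 / 2) < mu2).

(* [lowc], [diagc] and [upc] are the entries of the matrix of a first-order
   Dunkl operator on the circle x1 = 0 in the basis c^e s^l, where s = sin theta,
   c = cos theta and e in {0, 1} is the parity of N + l; its eigenvectors are the
   restrictions of the Z_S. *)
Definition lowc (i : nat) : R := if odd i then i%:R + 2 * mu2 else - i%:R.

Definition diagc (i : nat) : R :=
  if odd N then - (1 / 2) + (-1) ^+ i * (mu3 - mu2)
  else 1 / 2 + (-1) ^+ i * (mu2 + mu3).

Definition upc (i : nat) : R :=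
  if odd (N + i) then
    if odd N then i%:R + 1 + 2 * mu3 else - (i%:R + 1 + 2 * mu2 + 2 * mu3)
  else 0.

(** Acts on coefficient sequences rather than polynomials, because [Yh N.+1], in general an infinite
    series, formally occurs in the image of [Yh N]. *)
Definition opX (f : nat -> R) (l : nat) : R :=
  diagc l * f l + lowc l.+1 * f l.+1 + (if l is m.+1 then upc m * f m else 0).

(** Let e be the parity of N + i. The Jacobi factor of s^i c^e has degree m = (N - i - e) / 2 and
    parameters a = i + mu1 + mu2, b = mu3 - 1/2 + e; then [parA], [parB], [parC] are -m, m + a + b +
    1 and a + 1. *)
Definition parA (i : nat) : R :=
  - (N%:R - i%:R - (odd (N + i))%:R) / 2.
Definition parB (i : nat) : R :=
  (N%:R + i%:R + (odd (N + i))%:R) / 2 + mu1 + mu2 + mu3 + 1 / 2.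
Definition parC (i : nat) : R := i%:R + 1 + mu1 + mu2.

(* The coefficient of s^l in s^i 2F1(parA, parB; parC; s^2). *)
Definition G (i l : nat) : R :=
  if (i <= l)%N && ~~ odd (l - i) then
    hyp (parA i) (parB i) (parC i) (l - i)./2
  else 0.

(** The value forced by the coefficient of s^(i+1) in [opX_G]. At i = 0 the denominator
    [i + mu1 + mu2] may vanish, but it divides a multiple of [lowc 0 = 0]. *)
Definition upG (i : nat) : R :=
  if odd (N + i) then
    (lowc i - 2 * (-1) ^+ i) * parA i * parB i / parC i + upc i
    - lowc i * (parA i - 1) * (parB i - 1) / (i%:R + mu1 + mu2)
  else - (parA i * parB i / parC i) * (2 * (-1) ^+ i + lowc i / (i%:R + mu1 + mu2)).

Lemma lowc0 : lowc 0 = 0.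
Proof. by rewrite /lowc/= oppr0. Qed.

Lemma G_lt i l : (l < i)%N -> G i l = 0.
Proof. by rewrite /G ltnNge => /negbTE ->. Qed.

Lemma G_even i j : G i (i + j.*2) = hyp (parA i) (parB i) (parC i) j.
Proof. by rewrite /G leq_addr addKn odd_double doubleK. Qed.

Lemma G_odd i j : G i (i + j.*2.+1) = 0.
Proof. by rewrite /G leq_addr addKn oddS odd_double. Qed.

Lemma G_diag i : G i i = 1.
Proof. by have := G_even i 0; rewrite addn0 hyp0. Qed.

Let parC_gt0 i : 0 < parC i.
Proof.
by have := ler0n R i; move: hmu1 hmu2; rewrite /parC; lra.
Qed.

Let sgn_odd (i : nat) : (-1) ^+ i = if odd i then - 1 else 1 :> R.
Proof. by rewrite -signr_odd; case: odd; rewrite ?expr1 ?expr0. Qed.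

(** This is [opX_G] at s^(i+2j+1). Neighbouring series differ by shifts of the parameters, so
    [hyp_shift] and [hyp_shiftc] reduce all terms to one common [hyp] coefficient; which shifts
    occur depends on the parity of N + i. *)
Let G_rel i j :
  lowc (i + j.*2.+2) * hyp (parA i) (parB i) (parC i) j.+1
    + upc (i + j.*2) * hyp (parA i) (parB i) (parC i) j
  = (if i is m.+1 then lowc i * hyp (parA m) (parB m) (parC m) j.+1 else 0)
    + upG i * hyp (parA i.+1) (parB i.+1) (parC i.+1) j.
Proof.
have i0 := ler0n R i; have j0 := ler0n R j.
have oj : odd (i + j.*2.+2) = odd i by rewrite oddD oddS /= odd_double addbF.
have oj' : odd (i + j.*2) = odd i by rewrite oddD odd_double addbF.
have oj2 : odd (N + (i + j.*2)) = odd (N + i) by rewrite addnA oddD odd_double addbF.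
have oS : odd (N + i.+1) = ~~ odd (N + i) by rewrite addnS.
have c0 := parC_gt0 i.
have cS : parC i.+1 = parC i + 1 by rewrite /parC -natr1; ring.
have Hc := hyp_shiftc (parA i) (parB i) j c0.
have HS := hypS (parA i) (parB i) j c0.
have nj : (i + j.*2)%:R = i%:R + 2 * j%:R :> R by rewrite natrD -mul2n natrM.
have nj2 : (i + j.*2.+2)%:R = i%:R + 2 * j%:R + 2 :> R by rewrite !addnS -!natr1 nj; ring.
case: (boolP (odd (N + i))) => oNi.
  have aS : parA i.+1 = parA i.
    by rewrite /parA oS oNi -natr1/=; ring.
  have bS : parB i.+1 = parB i.
    by rewrite /parB oS oNi -natr1/=; ring.
  rewrite aS bS cS.
  have hc1 : hyp (parA i) (parB i) (parC i + 1) j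
    = parC i / (parC i + j%:R) * hyp (parA i) (parB i) (parC i) j.
    by rewrite mulrAC Hc; field; nonzero.
  rewrite hc1 HS /upG /upc oNi oj2 oNi nj.
  case: i i0 oj oj' oj2 oS c0 cS Hc HS nj nj2 oNi aS bS hc1 =>
    [|i] i0 oj oj' oj2 oS c0 cS Hc HS nj nj2 oNi aS bS hc1.
    rewrite lowc0 !mul0r subr0 add0r expr0.
    rewrite /lowc oj nj2/= /parA /parB oNi.
    move: oNi; rewrite addn0 => ->; rewrite -!natr1 /=.
    by rewrite /parC in c0 *; field; nonzero.
  have ci0 := parC_gt0 i.
  have ai : parA i = parA i.+1 - 1.
    by rewrite /parA; move: oNi; rewrite addnS /= => /negbTE ->; rewrite -[i.+1%:R]natr1/=; field.
  have bi : parB i = parB i.+1 - 1.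
    by rewrite /parB; move: oNi; rewrite addnS /= => /negbTE ->; rewrite -[i.+1%:R]natr1/=; field.
  have cc : parC i = parC i.+1 - 1 by rewrite /parC -natr1; ring.
  have H2 := hyp_shift (parA i) (parB i) j ci0.
  rewrite ai bi cc !subrK in H2 *.
  rewrite cc in ci0.
  have -> : hyp (parA i.+1 - 1) (parB i.+1 - 1) (parC i.+1 - 1) j.+1
    = (parA i.+1 - 1) * (parB i.+1 - 1) / ((parC i.+1 - 1) * j.+1%:R)
      * hyp (parA i.+1) (parB i.+1) (parC i.+1) j.
    by rewrite mulrAC -H2; field; nonzero.
  have -> : i.+1%:R + mu1 + mu2 = parC i.+1 - 1 by rewrite /parC; ring.
  set H := hyp _ _ _ j.
  rewrite /lowc oj nj2 sgn_odd /parA /parB oNi /parC; rewrite /parC in c0 ci0.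
  move: oNi; rewrite oddD.
  rewrite -!natr1; rewrite -!natr1 in c0 ci0 i0.
  case: (odd N); case: (odd i.+1) => // _.
    by field; nonzero.
  by field; nonzero.
have aS : parA i.+1 = parA i + 1.
  by rewrite /parA oS (negbTE oNi) -natr1/=; field.
have bS : parB i.+1 = parB i + 1.
  by rewrite /parB oS (negbTE oNi) -natr1/=; field.
rewrite aS bS cS /upc oj2 (negbTE oNi) mul0r addr0 /upG (negbTE oNi).
have H2 := hyp_shift (parA i) (parB i) j c0.
set w := lowc i / (i%:R + mu1 + mu2).
have E : - (parA i * parB i / parC i) * (2 * (-1) ^+ i + w) *
    hyp (parA i + 1) (parB i + 1) (parC i + 1) j
  = - (2 * (-1) ^+ i + w) * j.+1%:R
    * hyp (parA i) (parB i) (parC i) j.+1.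
  transitivity (- (2 * (-1) ^+ i + w) / parC i *
     (parA i * parB i * hyp (parA i + 1) (parB i + 1) (parC i + 1) j)); first ring.
  by rewrite -H2; field; nonzero.
rewrite {}E {}/w.
case: i i0 oj oj' oj2 oS c0 cS Hc HS nj nj2 oNi aS bS H2 =>
  [|i] i0 oj oj' oj2 oS c0 cS Hc HS nj nj2 oNi aS bS H2.
  rewrite lowc0 mul0r expr0 /lowc oj nj2/= -!natr1; ring.
have ci0 := parC_gt0 i.
have ai : parA i = parA i.+1.
  by rewrite /parA; move: oNi; rewrite addnS /= negbK => ->; rewrite -[i.+1%:R]natr1/=; field.
have bi : parB i = parB i.+1.
  by rewrite /parB; move: oNi; rewrite addnS /= negbK => ->; rewrite -[i.+1%:R]natr1/=; field.
have cc : parC i.+1 = parC i + 1 by rewrite /parC -natr1; ring.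
have Hc2 := hyp_shiftc (parA i.+1) (parB i.+1) j.+1 ci0.
rewrite ai bi cc.
have -> : hyp (parA i.+1) (parB i.+1) (parC i) j.+1
  = (parC i + j.+1%:R) / parC i * hyp (parA i.+1) (parB i.+1) (parC i + 1) j.+1.
  by rewrite mulrAC -Hc2; field; nonzero.
have -> : i.+1%:R + mu1 + mu2 = parC i by rewrite /parC -natr1; ring.
rewrite /lowc oj nj2 sgn_odd; case: (odd i.+1); rewrite -!natr1.
  by rewrite /parC in ci0 *; field; nonzero.
by rewrite /parC in ci0 *; field; nonzero.
Qed.

(** If l - i is even only the diagonal term contributes; if it is odd the identity is [G_rel], apart
    from the lowest power s^(i-1). *)
Lemma opX_G i l :
  opX (G i) l = lowc i * G i.-1 l + diagc i * G i l + upG i * G i.+1 l.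
Proof.
rewrite /opX.
have [li|il] := ltnP l.+1 i.
  rewrite !(@G_lt i)//; last exact: ltnW.
  rewrite (@G_lt i.-1) ?(@G_lt i.+1)//; last 2 first.
  - by rewrite ltnS ltnW// ltnW.
  - by case: i li.
  rewrite !mulr0; case: l li => [|m] li; first by rewrite !addr0.
  by rewrite G_lt ?mulr0 ?addr0//; apply: ltnW; apply: ltnW.
have /subnKC := il; set m := (l.+1 - i)%N => lE.
have := odd_double_half m; set j := m./2.
case: (odd m); rewrite ?add1n ?add0n => mE; rewrite -mE in lE; clearbody j; clear m mE.
  have {}lE : l = (i + j.*2)%N by move: lE; rewrite addnS => -[].
  rewrite {il}lE -addnS G_odd G_even mulr0 addr0.
  have -> : G i.+1 (i + j.*2) = 0.
    case: j => [|j]; first by rewrite addn0 G_lt.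
    by rewrite doubleS addnS -addSn G_odd.
  have -> : lowc i * G i.-1 (i + j.*2) = 0.
    case: i => [|i]; first by rewrite lowc0 mul0r.
    by rewrite /= addSn -addnS G_odd mulr0.
  have -> : (if (i + j.*2)%N is m.+1 then upc m * G i m else 0) = 0.
    case: j => [|j].
      by rewrite addn0; case: i => // i; rewrite G_lt// mulr0.
    by rewrite doubleS !addnS -addnS G_odd mulr0.
  rewrite mulr0 !addr0 add0r; congr (_ * _).
  rewrite /diagc; congr (if _ then _ + _ * _ else _ + _ * _).
    by rewrite exprD -mul2n exprM sqrrN expr1n expr1n mulr1.
  by rewrite exprD -mul2n exprM sqrrN expr1n expr1n mulr1.
case: j lE => [|j] lE.
  rewrite addn0 in lE; rewrite lE G_diag.
  rewrite (@G_lt l.+1 l)// (@G_lt l.+2 l)//= G_diag.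
  case: l {il lE} => [|l]; rewrite ?G_lt// !mulr0 !addr0 add0r//.
have {}lE : l = (i + j.*2).+1 by move: lE; rewrite doubleS !addnS => -[].
have := G_rel i j; rewrite lE; clear.
rewrite -!addnS -doubleS !G_even doubleS => H.
rewrite G_odd !mulr0 add0r.
have -> : (i + j.*2.+1)%N = (i.+1 + j.*2)%N by rewrite addnS.
rewrite G_even.
have -> : lowc i * G i.-1 (i.+1 + j.*2)
    = if i is m.+1 then lowc i * hyp (parA m) (parB m) (parC m) j.+1 else 0.
  case: i {H} => [|i]; first by rewrite lowc0 mul0r.
  by rewrite /= !addSn -!addnS -doubleS G_even.
by rewrite addr0 -H.
Qed.

Let mu : R := (-1) ^+ N * (N%:R + 1 + mu1 + mu2 + mu3).
Let rho1 : R := (mu2 + mu3) / 2.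
Let rho2 : R := (mu1 + mu) / 2.
Let r1 : R := (mu3 - mu2) / 2.
Let r2 : R := (mu - mu1) / 2.
Local Notation bA := (BI_A rho1 rho2 r1 r2).
Local Notation bC := (BI_C rho1 rho2 r1 r2).

(** The ratio of the two series in Y_K, once both start with coefficient 1. It vanishes at K = N,
    which removes the nonterminating [G N.+1] from [Yh N]. *)
Definition tau (K : nat) : R :=
  (if odd (N + K) then - ((N%:R - K%:R) / 2 + mu3) else (N%:R - K%:R) / 2) / parC K.

(* The coefficients of the restriction of Y_K, scaled to have leading term s^K. *)
Definition Yh (K l : nat) : R := G K l + tau K * G K.+1 l.

Let bK K : R := 2 * (rho1 - bA K - bC K) + 1 / 2.
Let aK K : R := 4 * (bA K * bC K.+1) / lowc K.+1.

Lemma lowc_neq0 K : lowc K.+1 != 0.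
Proof.
rewrite /lowc; case: ifP => _; last by rewrite oppr_eq0 natrS_neq0.
by apply: lt0r_neq0; have := ler0n R K; move: hmu2; rewrite -[K.+1%:R]natr1; lra.
Qed.

Let muE : mu = (if odd N then -1 else 1) * (N%:R + 1 + mu1 + mu2 + mu3).
Proof. by rewrite /mu sgn_odd. Qed.

(** The three relations compare the coefficients of [G K], [G K.+1] and [G K.+2] in [opX_Yh]; those
    of [G K.-1] agree by construction. This is where the Bannai-Ito coefficients appear. *)
Let rel1 K : diagc K + tau K * lowc K.+1 = lowc K * tau K.-1 + bK K.
Proof.
rewrite /bK /BI_A /BI_C /tau /parC /diagc sgn_odd /lowc /rho1 /rho2 /r1 /r2 muE.
move: hmu1 hmu2 => h1 h2.
case: K => [|K] /=.
  rewrite addn0 !mul0r; case: (odd N); field; nonzero.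
have K0 := ler0n R K.
rewrite !oddD /=; case: (odd N); case: (odd K); rewrite /= -!natr1; field; nonzero.
Qed.

Let rel2 K : upG K + tau K * diagc K.+1 = bK K * tau K + aK K.
Proof.
rewrite /bK /aK /upG /upc /parA /parB /BI_A /BI_C /tau /parC
  /diagc !sgn_odd /lowc /rho1 /rho2 /r1 /r2 muE.
move: hmu1 hmu2 => h1 h2.
case: K => [|K] /=.
  rewrite addn0 /= oppr0 !mul0r; case: (odd N); rewrite /= ?mul0r; field; nonzero.
have K0 := ler0n R K.
rewrite !oddD /=; case: (odd N); case: (odd K);
  rewrite /= -[K.+2%:R]natr1 -[K.+1%:R]natr1; field; nonzero.
Qed.

Let rel3 K : tau K * upG K.+1 = aK K * tau K.+1.
Proof.
rewrite /aK /upG /upc /parA /parB /BI_A /BI_C /tau /parC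
  /diagc !sgn_odd /lowc /rho1 /rho2 /r1 /r2 muE.
move: hmu1 hmu2 => h1 h2.
have K0 := ler0n R K.
rewrite !oddD /=; case: (odd N); case: (odd K); rewrite /= -[K.+1%:R]natr1; field; nonzero.
Qed.

Lemma opX_lin f g c l : opX (fun i => f i + c * g i) l = opX f l + c * opX g l.
Proof. by rewrite /opX; case: l => [|l]; ring. Qed.

Lemma opX_Yh K l : opX (Yh K) l
  = lowc K * Yh K.-1 l + (2 * (rho1 - bA K - bC K) + 1 / 2) * Yh K l
    + 4 * (bA K * bC K.+1) / lowc K.+1 * Yh K.+1 l.
Proof.
rewrite -/(bK K) -/(aK K) opX_lin !opX_G /=.
have -> : lowc K * Yh K.-1 l = lowc K * G K.-1 l + lowc K * tau K.-1 * G K l.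
  by rewrite /Yh; case: K => [|K]; rewrite ?lowc0 /=; ring.
rewrite /Yh.
transitivity (lowc K * G K.-1 l + (diagc K + tau K * lowc K.+1) * G K l
   + (upG K + tau K * diagc K.+1) * G K.+1 l + tau K * upG K.+1 * G K.+2 l); first ring.
rewrite rel1 rel2 rel3; ring.
Qed.

Lemma Yh_diag K : Yh K K = 1.
Proof. by rewrite /Yh G_diag G_lt// mulr0 addr0. Qed.

Lemma Yh_lt K l : (l < K)%N -> Yh K l = 0.
Proof. by move=> lK; rewrite /Yh !G_lt ?mulr0 ?addr0// ltnW. Qed.

Lemma Yh_free n (s : nat -> R) :
  (forall l, (l < n)%N -> \sum_(K < n) s K * Yh K l = 0) ->
  forall K, (K < n)%N -> s K = 0.
Proof.
move=> H K; elim/ltn_ind: K => K IH Kn.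
have := H _ Kn; rewrite (bigD1 (Ordinal Kn))//= Yh_diag mulr1 big1 ?addr0//.
move=> i; rewrite -val_eqE /= neq_ltn => /orP[iK|Ki].
  by rewrite IH// mul0r.
by rewrite Yh_lt ?mulr0.
Qed.

(** Expanding both sides of the eigenvalue equation in the triangular family [Yh] and comparing
    coefficients gives a three-term recurrence for r. *)
Lemma connection_BI (r z : nat -> R) (x : R) :
  (forall l, opX z l = (2 * x + 1 / 2) * z l) ->
  (forall l, z l = \sum_(K < N.+1) r K * Yh K l) ->
  forall K, (K <= N)%N ->
    r K * \prod_(1 <= i < K.+1) (lowc i / 2) = r 0 * (BI rho1 rho2 r1 r2 K).[x].
Proof.
move=> Hz Hr.
(* Extension by zero: [opX] raises the index by one, so the comparison runs over K <= N + 1. *)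
pose q K := if (K <= N)%N then r K else 0.
have qN K : (N < K)%N -> q K = 0 by rewrite /q ltnNge => /negbTE ->.
have {}Hr l : z l = \sum_(K < N.+1) q K * Yh K l.
  by rewrite Hr; apply: eq_bigr => K _; rewrite /q -ltnS ltn_ord.
have key K : (K < N.+2)%N ->
    lowc K.+1 * q K.+1 + (bK K - (2 * x + 1 / 2)) * q K
    + (if K is m.+1 then aK m * q m else 0) = 0.
  apply: (@Yh_free N.+2 (fun K => lowc K.+1 * q K.+1 + (bK K - (2 * x + 1 / 2)) * q K
    + (if K is m.+1 then aK m * q m else 0))) => l _.
  have opz : opX z l = \sum_(K < N.+1) q K * opX (Yh K) l.
    rewrite /opX !Hr; case: l => [|l]; rewrite ?Hr !mulr_sumr -!big_split/=;
      last by apply: eq_bigr => i _; ring.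
    by rewrite addr0; apply: eq_bigr => i _; ring.
  have E1 : \sum_(K < N.+2) lowc K.+1 * q K.+1 * Yh K l
      = \sum_(K < N.+1) q K * (lowc K * Yh K.-1 l).
    rewrite [RHS]big_ord_recl lowc0 !mul0r mulr0 add0r.
    rewrite 2!big_ord_recr /= !qN// !mulr0 !mul0r !addr0.
    by apply: eq_bigr => i _; rewrite /bump/= add1n /=; ring.
  have E2 : \sum_(K < N.+2) (if nat_of_ord K is m.+1 then aK m * q m else 0) * Yh K l
      = \sum_(K < N.+1) q K * (aK K * Yh K.+1 l).
    rewrite big_ord_recl mul0r add0r.
    by apply: eq_bigr => i _; rewrite !lift0; ring.
  have E3 (c : nat -> R) : \sum_(K < N.+2) (c K * q K) * Yh K l
      = \sum_(K < N.+1) q K * (c K * Yh K l).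
    rewrite big_ord_recr /= qN// mulr0 mul0r addr0.
    by apply: eq_bigr => i _; ring.
  pose c K := bK K - (2 * x + 1 / 2).
  transitivity (\sum_(K < N.+2) lowc K.+1 * q K.+1 * Yh K l
    + \sum_(K < N.+2) (c K * q K) * Yh K l
    + \sum_(K < N.+2) (if nat_of_ord K is m.+1 then aK m * q m else 0) * Yh K l).
    by rewrite -!big_split; apply: eq_bigr => i _ /=; rewrite /c; ring.
  rewrite E1 E2 E3 -!big_split/=.
  have := Hz l; rewrite opz Hr mulr_sumr => /eqP; rewrite -subr_eq0 -sumrB => /eqP H.
  rewrite -[RHS]H; apply: eq_bigr => i _.
  by rewrite opX_Yh -/(bK i) -/(aK i) /c; ring.
(* This scaling makes the recurrence monic: the leading factor [lowc K.+1 / 2] becomes 1, and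
   [aK K * lowc K.+1 / 4] is u_(K+1). *)
pose P K := \prod_(1 <= i < K.+1) (lowc i / 2).
have PS K : P K.+1 = P K * (lowc K.+1 / 2) by rewrite /P big_nat_recr.
have P0 : P 0 = 1 by rewrite /P big_geq.
have main K : (K < N.+2)%N -> q K * P K = q 0 * (BI rho1 rho2 r1 r2 K).[x]
   /\ q K.+1 * P K.+1 = q 0 * (BI rho1 rho2 r1 r2 K.+1).[x].
  elim: K => [|K IH] KN.
    split; first by rewrite P0 hornerC.
    have := key 0 KN; rewrite addr0 PS P0 => H.
    rewrite mul1r /= mulr1 hornerD hornerN horner0 subr0 hornerXsubC.
    transitivity (lowc 1 * q 1 / 2); first ring.
    have -> : lowc 1 * q 1 = - ((bK 0 - (2 * x + 1 / 2)) * q 0).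
      by apply/eqP; rewrite -addr_eq0 H.
    by rewrite /bK; field.
  have [IH1 IH2] := IH (ltnW KN); split => //.
  have /eqP := key K.+1 KN; rewrite -addrA addr_eq0 => /eqP H.
  have -> : BI rho1 rho2 r1 r2 K.+2 =
     ('X - (rho1 - bA K.+1 - bC K.+1)%:P) * BI rho1 rho2 r1 r2 K.+1
     - (bA K * bC K.+1) *: BI rho1 rho2 r1 r2 K by [].
  rewrite hornerD hornerN hornerM hornerXsubC hornerZ mulrBr.
  rewrite mulrCA -IH2 [q 0 * (_ * _)]mulrCA -IH1 2!PS.
  transitivity (lowc K.+2 * q K.+2 * (P K * (lowc K.+1 / 2)) / 2); first ring.
  rewrite H /bK /aK; field.
  exact: lowc_neq0.
move=> K KN; have := (main K (leqW KN)).1.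
by rewrite /q KN leq0n.
Qed.

End Tridiagonal.

(** * Restriction of the Z_S to a great circle *)

Section Circle.
Variable R : realType.
Implicit Types (f g : {poly R}) (N : nat) (theta : R).

(* A function on the circle x1 = 0, with x2 = sin theta and x3 = cos theta. *)
Definition circle_fun N f g theta : R :=
  if odd N then cos theta * f.[sin theta ^+ 2] + sin theta * g.[sin theta ^+ 2]
  else f.[sin theta ^+ 2] + sin theta * cos theta * g.[sin theta ^+ 2].

(** The index l is the total power of s, the variable of f and g being s^2. *)
Definition interleave f g (l : nat) : R := if odd l then g`_l./2 else f`_l./2.

Lemma poly_sqr_eq0 f : (forall x : R, 0 < x < 1 -> f.[x ^+ 2] = 0) -> f = 0.
Proof.
move=> H; apply/eqP; apply: contraT => f0.
pose s := [seq (i.+2%:R^-1 : R) ^+ 2 | i <- iota 0 (size f)].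
have := @max_poly_roots _ f s f0.
rewrite size_map size_iota ltnn => -> //.
  apply/allP => y /mapP[i _ ->]; apply/eqP/H.
  by rewrite invr_gt0 ltr0n/= invf_lt1 ?ltr0n// ltr1n.
rewrite map_inj_in_uniq ?iota_uniq// => i j _ _ /eqP.
rewrite eqrXn2 ?invr_ge0// => /eqP/invr_inj/eqP.
by rewrite eqr_nat => /eqP[].
Qed.

(** The angles [asin x] and [- asin x] have opposite sines and equal cosines, which separates f from
    g. *)
Lemma circle_fun_eq0 N f g :
  (forall theta, circle_fun N f g theta = 0) -> f = 0 /\ g = 0.
Proof.
move=> H.
have Hx x : 0 < x < 1 -> f.[x ^+ 2] = 0 /\ g.[x ^+ 2] = 0.
  move=> /andP[x0 x1].
  have xI : x \in `[(-1), 1] by rewrite in_itv/=; apply/andP; split; lra.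
  have c0 : 0 < cos (asin x).
    rewrite cos_asin; last by move: xI; rewrite in_itv.
    by rewrite sqrtr_gt0 subr_gt0 expr_lt1// ltW.
  have := H (asin x); have := H (- asin x).
  rewrite /circle_fun sinN cosN sqrrN asinK//.
  set c := cos _ in c0 *; set p := f.[_]; set q := g.[_].
  case: odd => h1 h2.
    have e1 : c * p = 0 by lra.
    have e2 : x * q = 0 by lra.
    by split; apply/eqP; [move/eqP: e1|move/eqP: e2];
      rewrite mulf_eq0 gt_eqF.
  have e1 : p = 0 by lra.
  have e2 : (x * c) * q = 0 by lra.
  split => //; apply/eqP; move/eqP: e2.
  by rewrite mulf_eq0 gt_eqF ?mulr_gt0.
by split; apply: poly_sqr_eq0 => x /Hx[].
Qed.

Lemma circle_fun_sum N n (c : 'I_n -> R) (f g : 'I_n -> {poly R}) theta :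
  \sum_(i < n) c i * circle_fun N (f i) (g i) theta
  = circle_fun N (\sum_(i < n) c i *: f i) (\sum_(i < n) c i *: g i) theta.
Proof.
rewrite /circle_fun; case: odd; rewrite !horner_sum !mulr_sumr -big_split/=;
  apply: eq_bigr => i _; rewrite !hornerZ; ring.
Qed.

Lemma circle_fun_sum_inj N n (f0 g0 : {poly R}) (c : 'I_n -> R) (f g : 'I_n -> {poly R}) :
  (forall theta, circle_fun N f0 g0 theta
     = \sum_(i < n) c i * circle_fun N (f i) (g i) theta) ->
  forall l, interleave f0 g0 l = \sum_(i < n) c i * interleave (f i) (g i) l.
Proof.
move=> H.
have [] := @circle_fun_eq0 N (f0 - \sum_(i < n) c i *: f i) (g0 - \sum_(i < n) c i *: g i).
  move=> theta; apply/eqP; have /eqP := H theta; rewrite circle_fun_sum -subr_eq0.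
  rewrite /circle_fun; case: odd; rewrite !hornerD !hornerN; congr (_ == 0); ring.
move=> /eqP; rewrite subr_eq0 => /eqP -> /eqP; rewrite subr_eq0 => /eqP -> l.
by rewrite /interleave; case: odd; rewrite coef_sum; apply: eq_bigr => i _; rewrite coefZ.
Qed.

Lemma jacobi_cos2 (m : int) (a b theta : R) :
  jacobi m a b (cos (2 * theta)) = (jacp m a b).[sin theta ^+ 2].
Proof.
rewrite jacobiE; congr (_.[_]).
by rewrite mulr_natl cos_mulr2n sin2cos2 -mulr_natl; field.
Qed.

(** * The eigenvalue equation of the restricted Z_S *)

Variables mu2 mu3 : R.
Hypotheses (hmu2 : - (1 / 2) < mu2) (hmu3 : - (1 / 2) < mu3).

Lemma coef_Xderiv (f : {poly R}) j : ('X * f^`())`_j = j%:R * f`_j.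
Proof. by rewrite mulrC coefMX; case: j => [|j]; rewrite ?mul0r// coef_deriv mulr_natl. Qed.

(** The hypotheses are the even and odd parts in s of the eigenvalue equation, in the variable v =
    s^2: a factor j on the j-th coefficient is the operator v d/dv. *)
Lemma interleave_opX_even N f g x : odd N = false ->
  (1 / 2 + mu2 + mu3) *: f + (1 + 2 * mu2) *: g + 2 *: ('X * (1 - 'X) * g^`())
    - (2 + 2 * mu2 + 2 * mu3) *: ('X * g) = x *: f ->
  (1 / 2 - mu2 - mu3) *: g - 2 *: f^`() = x *: g ->
  forall l, opX mu2 mu3 N (interleave f g) l = x * interleave f g l.
Proof.
move=> oN H1 H2 l; rewrite /opX /diagc oN -signr_odd.
have {}H1 j : (1 / 2 + mu2 + mu3) * f`_j + (1 + 2 * mu2 + 2 * j%:R) * g`_j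
    - (if j is i.+1 then (2 + 2 * mu2 + 2 * mu3 + 2 * i%:R) * g`_i else 0) = x * f`_j.
  have := congr1 (fun p : {poly R} => p`_j) H1.
  have -> : 'X * (1 - 'X) * g^`() = 'X * g^`() - 'X * ('X * g^`()) by ring.
  rewrite !(coefD, coefN, coefZ) coef_Xderiv [('X * ('X * _))`_j]coefXM [('X * g)`_j]coefXM => <-.
  by case: j => [|j] /=; rewrite ?coef_Xderiv; ring.
have {}H2 j : (1 / 2 - mu2 - mu3) * g`_j - 2 * j.+1%:R * f`_j.+1 = x * g`_j.
  have := congr1 (fun p : {poly R} => p`_j) H2.
  rewrite !(coefD, coefN, coefZ) coef_deriv -[_ *+ _.+1]mulr_natl => <-; ring.
have := odd_double_half l; set j := l./2; case: (boolP (odd l)) => ol <-.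
  rewrite add1n /interleave/= !odd_double /= uphalf_double doubleK -H2.
  rewrite /lowc /= negbK odd_double /upc oddD oN odd_double mul0r addr0 expr1.
  by rewrite -mul2n -!natr1 natrM; ring.
rewrite add0n /interleave/= !odd_double /= uphalf_double doubleK -H1.
rewrite /lowc /= odd_double /= expr0 -natr1.
case: j => [|j]; rewrite ?double0 ?doubleS /= ?odd_double /=; first ring.
rewrite uphalf_double /upc oddD oN /= odd_double /= -!natr1 -mul2n natrM; ring.
Qed.

Lemma interleave_opX_odd N f g x : odd N ->
  (- (1 / 2) - mu2 + mu3) *: f + (1 + 2 * mu2) *: g + 2 *: ('X * g^`()) = x *: f ->
  (- (1 / 2) + mu2 - mu3) *: g + (1 + 2 * mu3) *: f + 2 *: ('X * f^`()) - 2 *: f^`()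
    = x *: g ->
  forall l, opX mu2 mu3 N (interleave f g) l = x * interleave f g l.
Proof.
move=> oN H1 H2 l; rewrite /opX /diagc oN -signr_odd.
have {}H1 j : (- (1 / 2) - mu2 + mu3) * f`_j + (1 + 2 * mu2 + 2 * j%:R) * g`_j = x * f`_j.
  have := congr1 (fun p : {poly R} => p`_j) H1.
  rewrite !(coefD, coefN, coefZ) coef_Xderiv => <-; ring.
have {}H2 j : (- (1 / 2) + mu2 - mu3) * g`_j + (1 + 2 * mu3 + 2 * j%:R) * f`_j
     - 2 * j.+1%:R * f`_j.+1 = x * g`_j.
  have := congr1 (fun p : {poly R} => p`_j) H2.
  rewrite !(coefD, coefN, coefZ) coef_Xderiv coef_deriv -[_ *+ j.+1]mulr_natl => <-; ring.
have := odd_double_half l; set j := l./2; case: (boolP (odd l)) => ol <-.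
  rewrite add1n /interleave/= !odd_double /= uphalf_double doubleK -H2.
  rewrite /lowc /= negbK odd_double /upc oddD oN odd_double /= expr1.
  by rewrite -mul2n -!natr1 natrM; ring.
rewrite add0n /interleave/= !odd_double /= uphalf_double doubleK -H1.
rewrite /lowc /= odd_double /= expr0 -natr1.
case: j => [|j]; rewrite ?double0 ?doubleS /= ?odd_double /=; first ring.
rewrite /upc oddD oN /= odd_double /= -!natr1 -mul2n natrM; ring.
Qed.

(** Naming the two square roots turns identities with half-integer powers into rational ones in u
    and v, within reach of [field]. *)
Lemma powR_half_ratio (x y : R) : 0 < x -> 0 < y ->
  exists u v, [/\ 0 < u, 0 < v, u ^+ 2 = x, v ^+ 2 = y
    & (x / y) `^ (1 / 2) = u / v].
Proof.
move=> x0 y0; exists (Num.sqrt x), (Num.sqrt y).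
split; rewrite ?sqrtr_gt0// ?sqr_sqrtr ?ltW//.
by rewrite div1r powR12_sqrt ?divr_ge0 ?ltW// sqrtrM ?sqrtrV ?ltW.
Qed.

(* The parts of [Fp] and [Fm] at [pi / 2 - theta], the angle phi of Z_S at the point
   [theta] of the circle x1 = 0. *)
Definition Zp_poly (S : nat) : {poly R} * {poly R} :=
  let k := S./2 in let p : nat := odd S in
  ((zetap mu2 mu3 S * ((k%:R + 1) / (k%:R + mu2 + mu3 + 1)) `^ (p%:R / 2))
     *: (jacp (k%:Z + p%:Z) (mu3 - 1 / 2) (mu2 - 1 / 2) \Po (1 - 'X)),
   (- zetap mu2 mu3 S * (-1) ^+ p * ((k%:R + mu2 + mu3 + 1) / (k%:R + 1)) `^ (p%:R / 2))
     *: (jacp (k%:Z + p%:Z - 1) (mu3 + 1 / 2) (mu2 + 1 / 2) \Po (1 - 'X))).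

Definition Zm_poly (S : nat) : {poly R} * {poly R} :=
  let k := S./2 in let p : nat := odd S in
  ((zetam mu2 mu3 S * ((k%:R + mu2 + 1 / 2) / (k%:R + mu3 + 1 / 2)) `^ (p%:R / 2))
     *: (jacp k%:Z (mu3 + 1 / 2) (mu2 - 1 / 2) \Po (1 - 'X)),
   (zetam mu2 mu3 S * (-1) ^+ p * ((k%:R + mu3 + 1 / 2) / (k%:R + mu2 + 1 / 2)) `^ (p%:R / 2))
     *: (jacp k%:Z (mu3 - 1 / 2) (mu2 + 1 / 2) \Po (1 - 'X))).

Let horner_flip (f : {poly R}) theta : f.[cos theta ^+ 2] = (f \Po (1 - 'X)).[sin theta ^+ 2].
Proof. by rewrite horner_comp hornerD hornerN hornerC hornerX cos2sin2. Qed.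

Let cos_flip theta : cos (pi / 2 - theta) = sin theta.
Proof. by rewrite -opprB cosN cosBpihalf. Qed.

Let sin_flip theta : sin (pi / 2 - theta) = cos theta.
Proof. by rewrite -opprB sinN sinBpihalf opprK. Qed.

Lemma Fp_circle N S theta : odd N = false ->
  Fp mu2 mu3 S (pi / 2 - theta) = circle_fun N (Zp_poly S).1 (Zp_poly S).2 theta.
Proof.
move=> oN; rewrite /Fp /circle_fun oN /Zp_poly /= !jacobi_cos2 cos_flip sin_flip.
rewrite !hornerZ -!horner_flip; ring.
Qed.

Lemma Fm_circle N S theta : odd N ->
  Fm mu2 mu3 S (pi / 2 - theta) = circle_fun N (Zm_poly S).1 (Zm_poly S).2 theta.
Proof.
move=> oN; rewrite /Fm /circle_fun oN /Zm_poly /= !jacobi_cos2 cos_flip sin_flip.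
rewrite !hornerZ -!horner_flip; ring.
Qed.

Let deriv_flip (f : {poly R}) : (f \Po (1 - 'X))^`() = - (f^`() \Po (1 - 'X)).
Proof. by rewrite deriv_comp derivB derivX -[1]/(1%:P) derivC sub0r mulrN1. Qed.

Let natr_half (S : nat) : S%:R = 2 * (S./2)%:R + (odd S)%:R :> R.
Proof. by rewrite -{1}(odd_double_half S) -mul2n natrD natrM addrC. Qed.

(** The shift relations exchange P and Q, so the operator acts on the pair as a 2 by 2 matrix. E0
    and E1 say that the constants of [Fp] form an eigenvector; the sign of the eigenvalue is the
    parity of S. *)
Lemma Zp_eigen N S : odd N = false -> forall l,
  opX mu2 mu3 N (interleave (Zp_poly S).1 (Zp_poly S).2) l
  = ((-1) ^+ S * (S%:R + mu2 + mu3 + 1 / 2)) * interleave (Zp_poly S).1 (Zp_poly S).2 l.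
Proof.
move=> oN; rewrite /Zp_poly; set k := S./2; set z := zetap _ _ _; cbv zeta.
set m := (k + odd S)%N.
have a1 : -1 < mu3 - 1 / 2 by move: hmu3; lra.
have -> : mu3 + 1 / 2 = mu3 - 1 / 2 + 1 by field.
have -> : mu2 + 1 / 2 = mu2 - 1 / 2 + 1 by field.
have -> : k%:Z + (odd S)%:Z = m by rewrite PoszD.
have := jacp_deriv m (mu2 - 1 / 2) a1; have /= := jacp_dual_deriv m (mu2 - 1 / 2) a1.
set P := jacp m _ _; set Q := jacp _ _ _ => /(congr1 (fun p => p \Po (1 - 'X))) H1.
move=> /(congr1 (fun p => p \Po (1 - 'X))) H2.
rewrite !(comp_polyB, comp_polyD, comp_polyZ, comp_polyM, comp_polyX, comp_polyC) in H1 H2.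
set c0 := z * _; set c1 := - z * _ * _.
have [E0 E1] : (1 / 2 + mu2 + mu3) * c0 - 2 * m%:R * c1
      = ((-1) ^+ S * (S%:R + mu2 + mu3 + 1 / 2)) * c0
  /\ (1 / 2 - mu2 - mu3) * c1 - 2 * (m%:R + mu2 + mu3) * c0
      = ((-1) ^+ S * (S%:R + mu2 + mu3 + 1 / 2)) * c1.
  have k0 := ler0n R k.
  rewrite /c0 /c1 /m (natr_half S) -(signr_odd _ S); case: (odd S) => /=; last first.
    by rewrite mul0r !powRr0 addn0; split; ring.
  have x0 : 0 < k%:R + 1 :> R by lra.
  have y0 : 0 < k%:R + mu2 + mu3 + 1 by move: hmu2 hmu3; lra.
  have [u [v [u0 v0 uE vE ->]]] := powR_half_ratio x0 y0.
  have [v' [u' [v0' u0' vE' uE' ->]]] := powR_half_ratio y0 x0.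
  have -> : u' = u by apply/eqP; rewrite -(@eqrXn2 _ 2%N)// ?ltW// uE uE'.
  have -> : v' = v by apply/eqP; rewrite -(@eqrXn2 _ 2%N)// ?ltW// vE vE'.
  (* The parameters are eliminated in favour of the square roots, which leaves rational
     identities. *)
  have kE : k%:R = u ^+ 2 - 1 by rewrite uE; ring.
  have mE : mu2 = v ^+ 2 - u ^+ 2 - mu3 by rewrite uE vE; ring.
  rewrite natrD mE kE expr1.
  by split; field; rewrite !gt_eqF.
apply: interleave_opX_even => //=.
- transitivity (((1 / 2 + mu2 + mu3) * c0) *: (P \Po (1 - 'X))
      - (2 * c1) *: (m%:R *: (P \Po (1 - 'X)))); last first.
    by rewrite !scalerA -scalerBl mulrAC E0.
  rewrite -H1 derivZ deriv_flip.
  have -> : 1 + 2 * mu2 = 2 * (mu2 - 1 / 2 + 1) by field.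
  have -> : 2 + 2 * mu2 + 2 * mu3 = 2 * (mu2 - 1 / 2 + 1) + 2 * (mu3 - 1 / 2 + 1) by field.
  move: (1 / 2 + mu2 + mu3) (mu2 - 1 / 2 + 1) (mu3 - 1 / 2 + 1) (Q \Po _) (Q^`() \Po _).
  move: (P \Po _) => p c a b q q'.
  by rewrite -!mul_polyC; ring.
- rewrite derivZ deriv_flip H2.
  have -> : - (m%:R + (mu3 - 1 / 2) + (mu2 - 1 / 2) + 1) = - (m%:R + mu2 + mu3) by field.
  by rewrite [RHS]scalerA -E1; move: (Q \Po _) => q; rewrite -!mul_polyC; ring.
Qed.

(** As for [Zp_eigen], with the mixed relations, which keep the degree. *)
Lemma Zm_eigen N S : odd N -> forall l,
  opX mu2 mu3 N (interleave (Zm_poly S).1 (Zm_poly S).2) l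
  = ((-1) ^+ S * (S%:R + mu2 + mu3 + 1 / 2)) * interleave (Zm_poly S).1 (Zm_poly S).2 l.
Proof.
move=> oN; rewrite /Zm_poly; set k := S./2; set z := zetam _ _ _; cbv zeta.
have a1 : -1 < mu3 - 1 / 2 by move: hmu3; lra.
have -> : mu3 + 1 / 2 = mu3 - 1 / 2 + 1 by field.
have -> : mu2 + 1 / 2 = mu2 - 1 / 2 + 1 by field.
have := jacp_mixed_deriv k (mu2 - 1 / 2) a1; have := jacp_mixed_dual_deriv k (mu2 - 1 / 2) a1.
set P := jacp _ (_ + 1) _; set Q := jacp _ _ _ => /(congr1 (fun p => p \Po (1 - 'X))) H1.
move=> /(congr1 (fun p => p \Po (1 - 'X))) H2.
rewrite !(comp_polyB, comp_polyD, comp_polyZ, comp_polyM, comp_polyX, comp_polyC) in H1 H2.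
set c0 := z * _; set c1 := z * _ * _.
have [E0 E1] : (- (1 / 2) - mu2 + mu3) * c0 + 2 * (k%:R + mu2 + 1 / 2) * c1
      = ((-1) ^+ S * (S%:R + mu2 + mu3 + 1 / 2)) * c0
  /\ (- (1 / 2) + mu2 - mu3) * c1 + 2 * (k%:R + mu3 + 1 / 2) * c0
      = ((-1) ^+ S * (S%:R + mu2 + mu3 + 1 / 2)) * c1.
  have k0 := ler0n R k.
  rewrite /c0 /c1 (natr_half S) -(signr_odd _ S); case: (odd S) => /=; last first.
    by rewrite mul0r !powRr0; split; field.
  have x0 : 0 < k%:R + mu2 + 1 / 2 by move: hmu2; lra.
  have y0 : 0 < k%:R + mu3 + 1 / 2 by move: hmu3; lra.
  have [u [v [u0 v0 uE vE]]] := powR_half_ratio x0 y0.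
  have [v' [u' [v0' u0' vE' uE']]] := powR_half_ratio y0 x0.
  have -> : u' = u by apply/eqP; rewrite -(@eqrXn2 _ 2%N)// ?ltW// uE uE'.
  have -> : v' = v by apply/eqP; rewrite -(@eqrXn2 _ 2%N)// ?ltW// vE vE'.
  move=> -> ->.
  have m2E : mu2 = u ^+ 2 - k%:R - 1 / 2 by rewrite uE; field.
  have m3E : mu3 = v ^+ 2 - k%:R - 1 / 2 by rewrite vE; field.
  rewrite m2E m3E expr1.
  by split; field; rewrite !gt_eqF.
apply: interleave_opX_odd => //=.
- transitivity (((- (1 / 2) - mu2 + mu3) * c0) *: (P \Po (1 - 'X))
      + (2 * c1) *: ((k%:R + (mu2 - 1 / 2) + 1) *: (P \Po (1 - 'X)))); last first.
    by rewrite !scalerA -scalerDl -E0; congr (_ *: _); field.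
  rewrite -H1 derivZ deriv_flip.
  have -> : 1 + 2 * mu2 = 2 * (mu2 - 1 / 2 + 1) by field.
  move: (- (1 / 2) - mu2 + mu3) (mu2 - 1 / 2 + 1) (mu3 - 1 / 2 + 1) (Q \Po _) (Q^`() \Po _).
  move: (P \Po _) => p c a b q q'.
  by rewrite -!mul_polyC; ring.
- transitivity (((- (1 / 2) + mu2 - mu3) * c1) *: (Q \Po (1 - 'X))
      + (2 * c0) *: ((k%:R + (mu3 - 1 / 2) + 1) *: (Q \Po (1 - 'X)))); last first.
    by rewrite !scalerA -scalerDl -E1; congr (_ *: _); field.
  rewrite -H2 derivZ deriv_flip.
  have -> : 1 + 2 * mu3 = 2 * (mu3 - 1 / 2 + 1) by field.
  move: (- (1 / 2) + mu2 - mu3) (mu2 - 1 / 2 + 1) (mu3 - 1 / 2 + 1) (P \Po _) (P^`() \Po _).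
  move: (Q \Po _) => p c a b q q'.
  by rewrite -!mul_polyC; ring.
Qed.

End Circle.

(** * Restriction of the Y_K to a great circle *)

(* A sealed copy of [Gamma]: otherwise failing conversion tests unfold the integral. *)
HB.lock Definition Gam (R : realType) (x : R) : R := Gamma x.

(* Rewrites an argument of [Gam] equal to [y] into the form [y]. *)
Ltac gamma_arg y :=
  match goal with |- context [@Gam ?R ?a] =>
    tryif constr_eq a y then fail else
    (let H := fresh in assert (H : Gam a = Gam y);
      [congr (Gam _); by field | rewrite H; clear H])
  end.

Ltac positive := repeat first
  [assumption | exact: ltr01 | apply: mulr_gt0 | rewrite invr_gt0].

Section SealedGamma.
Variable R : realType.
Implicit Types (x : R) (n : nat).

Lemma GamE x : Gamma x = Gam x.
Proof. by rewrite Gam.unlock. Qed.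

Lemma Gam_gt0 x : 0 < x -> 0 < Gam x.
Proof. by rewrite -GamE; exact: Gamma_gt0. Qed.

Lemma Gamn_gt0 x n : 0 < x -> 0 < Gam (x + n%:R).
Proof. by move=> x0; rewrite Gam_gt0// ltr_wpDr. Qed.

Lemma Gam_neq0 x n : 0 < x -> Gam (x + n%:R) != 0.
Proof. by move=> x0; rewrite lt0r_neq0// Gamn_gt0. Qed.

Lemma GamSn x n : 0 < x -> Gam (x + n.+1%:R) = (x + n%:R) * Gam (x + n%:R).
Proof. by move=> x0; rewrite -natr1 addrA -!GamE GammaS// ltr_wpDr. Qed.

Lemma Gam_poch x n : 0 < x -> Gam (x + n%:R) = poch x n * Gam x.
Proof.
move=> x0; elim: n => [|n IH]; first by rewrite addr0 poch0 mul1r.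
by rewrite GamSn// IH pochS; ring.
Qed.

Lemma pochE x n : 0 < x -> poch x n = Gam (x + n%:R) / Gam x.
Proof. by move=> x0; rewrite Gam_poch// mulfK// lt0r_neq0// Gam_gt0. Qed.

End SealedGamma.

Section CoefficientsY.
Variables (R : realType) (mu1 mu2 mu3 : R).
Hypotheses (hmu1 : - (1 / 2) < mu1) (hmu2 : - (1 / 2) < mu2).
Implicit Types (N K n k d : nat) (theta phi : R).

(* The constants in front of the terms with [Fp] and with [Fm] in [Yfun]. *)
Definition Ycoefp N K : R :=
  let n := N./2 in let k := K./2 in let p : nat := odd K in
  if odd N then
    (-1) ^+ K *
    Num.sqrt ((n - k)`!%:R * Gamma (n%:R + k%:R + mu1 + mu2 + mu3 + 3 / 2 + p%:R)
              / (Gamma (n%:R - k%:R + mu3 + 1 / 2)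
                 * Gamma (n%:R + k%:R + mu1 + mu2 + 1 + p%:R))) *
    ((n%:R + k%:R + mu1 + mu2 + 1) / (n%:R - k%:R + mu3 + 1 / 2)) `^ ((1 - p%:R) / 2)
  else
    Num.sqrt ((n - k - p)`!%:R * Gamma (n%:R + k%:R + mu1 + mu2 + mu3 + 3 / 2)
              / (Gamma (n%:R + k%:R + mu1 + mu2 + 1)
                 * Gamma (n%:R - k%:R + mu3 + 1 / 2 - p%:R))) *
    ((n%:R - k%:R + mu3 - 1 / 2) / (n%:R + k%:R + mu1 + mu2 + 1)) `^ (p%:R / 2).

Definition Ycoefm N K : R :=
  let n := N./2 in let k := K./2 in let p : nat := odd K in
  if odd N then
    - ((-1) ^+ K *
    Num.sqrt ((n - k)`!%:R * Gamma (n%:R + k%:R + mu1 + mu2 + mu3 + 3 / 2 + p%:R)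
              / (Gamma (n%:R - k%:R + mu3 + 1 / 2)
                 * Gamma (n%:R + k%:R + mu1 + mu2 + 1 + p%:R))) *
    ((n%:R - k%:R + mu3 + 1 / 2) / (n%:R + k%:R + mu1 + mu2 + 1)) `^ ((1 - p%:R) / 2))
  else
    Num.sqrt ((n - k - p)`!%:R * Gamma (n%:R + k%:R + mu1 + mu2 + mu3 + 3 / 2)
              / (Gamma (n%:R + k%:R + mu1 + mu2 + 1)
                 * Gamma (n%:R - k%:R + mu3 + 1 / 2 - p%:R))) *
    ((n%:R + k%:R + mu1 + mu2 + 1) / (n%:R - k%:R + mu3 - 1 / 2)) `^ (p%:R / 2).

Definition Yjacp N K : int * R * R :=
  let n := N./2 in let k := K./2 in let p : nat := odd K in
  (n%:Z - k%:Z - p%:Z, 2 * k%:R + 2 * p%:R + mu1 + mu2,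
   if odd N then mu3 + 1 / 2 else mu3 - 1 / 2).

Definition Yjacm N K : int * R * R :=
  let n := N./2 in let k := K./2 in
  (if odd N then n%:Z - k%:Z else n%:Z - k%:Z - 1, 2 * k%:R + 1 + mu1 + mu2,
   if odd N then mu3 - 1 / 2 else mu3 + 1 / 2).

Lemma YfunE N K theta phi : Yfun mu1 mu2 mu3 N K theta phi =
  Ycoefp N K * cos theta ^+ odd N * sin theta ^+ (2 * K./2 + 2 * odd K)
    * jacobi (Yjacp N K).1.1 (Yjacp N K).1.2 (Yjacp N K).2 (cos (2 * theta))
    * Fp mu1 mu2 K phi
  + Ycoefm N K * cos theta ^+ (~~ odd N) * sin theta ^+ (2 * K./2 + 1)
    * jacobi (Yjacm N K).1.1 (Yjacm N K).1.2 (Yjacm N K).2 (cos (2 * theta))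
    * Fm mu1 mu2 K phi.
Proof.
by rewrite /Yfun /Yodd /Yeven /Ycoefp /Ycoefm /Yjacp /Yjacm; case: (odd N);
  rewrite /= expr0 expr1; ring.
Qed.

Definition Y_poly N K : {poly R} * {poly R} :=
  let: (mp, ap, bp) := Yjacp N K in let: (mm, am, bm) := Yjacm N K in
  ((Ycoefp N K * Fp mu1 mu2 K (pi / 2)) *: ('X^(K./2 + odd K) * jacp mp ap bp),
   (Ycoefm N K * Fm mu1 mu2 K (pi / 2)) *: ('X^(K./2) * jacp mm am bm)).

Lemma Yfun_circle N K theta :
  Yfun mu1 mu2 mu3 N K theta (pi / 2)
  = circle_fun N (Y_poly N K).1 (Y_poly N K).2 theta.
Proof.
rewrite YfunE /circle_fun /Y_poly !jacobi_cos2 /=.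
rewrite !hornerZ !hornerM !hornerXn -!exprM mulnDr.
rewrite [sin theta ^+ (_ + 1)]exprD expr1.
by case: (odd N); rewrite /= expr0 expr1; ring.
Qed.

Lemma Yfun_equator N K phi :
  Yfun mu1 mu2 mu3 N K (pi / 2) phi =
  if odd N then
    Ycoefm N K * jacobi (Yjacm N K).1.1 (Yjacm N K).1.2 (Yjacm N K).2 (-1)
      * Fm mu1 mu2 K phi
  else
    Ycoefp N K * jacobi (Yjacp N K).1.1 (Yjacp N K).1.2 (Yjacp N K).2 (-1)
      * Fp mu1 mu2 K phi.
Proof.
have c2 : cos (2 * (pi / 2)) = -1 :> R by rewrite mulrC divfK ?pnatr_eq0// cospi.
rewrite YfunE c2 cos_pihalf sin_pihalf !expr1n.
by case: (odd N); rewrite /= expr0 expr1; ring.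
Qed.

Lemma coef_Xn_jacp e (m : nat) (a b : R) j : ('X^e * jacp m a b)`_j
  = jacobi m a b 1 * (if (e <= j)%N then hyp (- m%:R) (m%:R + a + b + 1) (a + 1) (j - e) else 0).
Proof.
rewrite coefXnM jacobi1; case: ltnP => _; first by rewrite mulr0.
by rewrite coef_jacp.
Qed.

(** The parity of l selects one of the two terms on each side; after that only the hypergeometric
    parameters have to be matched. *)
Lemma interleave_jacp N e n k (c1 c2 : R) : n = N./2 -> forall l,
  interleave
   (c1 *: ('X^e * jacp (n%:Z - e%:Z) (2 * e%:R + mu1 + mu2)
                    (if odd N then mu3 + 1 / 2 else mu3 - 1 / 2)))
   (c2 *: ('X^k * jacp (if odd N then n%:Z - k%:Z else n%:Z - k%:Z - 1)
                    (2 * k%:R + 1 + mu1 + mu2)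
                    (if odd N then mu3 - 1 / 2 else mu3 + 1 / 2))) l
  = c1 * jacobi (n%:Z - e%:Z) (2 * e%:R + mu1 + mu2)
          (if odd N then mu3 + 1 / 2 else mu3 - 1 / 2) 1 * G mu1 mu2 mu3 N e.*2 l
  + c2 * jacobi (if odd N then n%:Z - k%:Z else n%:Z - k%:Z - 1) (2 * k%:R + 1 + mu1 + mu2)
          (if odd N then mu3 - 1 / 2 else mu3 + 1 / 2) 1 * G mu1 mu2 mu3 N k.*2.+1 l.
Proof.
move=> nE l.
have NE : N%:R = 2 * n%:R + (odd N)%:R :> R.
  by rewrite -{1}(odd_double_half N) -nE -mul2n natrD natrM addrC.
have := odd_double_half l; set j := l./2; rewrite /interleave; case: (boolP (odd l)) => ol lE.
  have -> : G mu1 mu2 mu3 N e.*2 l = 0.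
    rewrite -lE add1n; have [ej|je] := leqP e j; last by rewrite G_lt// ltn_Sdouble.
    by rewrite -(subnKC ej) doubleD -addnS G_odd.
  rewrite mulr0 add0r coefZ -mulrA; congr (_ * _).
  set m := (if odd N then _ else _).
  have mE : m = n%:Z - k%:Z - (~~ odd N)%:Z by rewrite /m; case: odd; rewrite ?subr0.
  (* A negative degree makes both sides zero, so the parameters need matching only for m >= 0. *)
  case: m mE => m mE; last by rewrite /jacp /jacobi mulr0 coef0 mul0r.
  rewrite coef_Xn_jacp; congr (_ * _).
  have mR : m%:R = n%:R - k%:R - (~~ odd N)%:R :> R.
    have : (m%:Z + k%:Z + (~~ odd N)%:Z = n%:Z)%R by rewrite mE; ring.
    by rewrite -!PoszD => -[<-]; rewrite !natrD; ring.
  case: leqP => [kj|jk]; last by rewrite -lE add1n G_lt// ltnS ltn_double.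
  rewrite -/j in kj *.
  have -> : l = (k.*2.+1 + (j - k).*2)%N by rewrite -lE add1n addSn -doubleD subnKC.
  rewrite G_even.
  have oNk : odd (N + k.*2.+1) = ~~ odd N by rewrite addnS /= oddD odd_double addbF.
  congr (hyp _ _ _ _).
  - by rewrite /parA oNk mR NE -mul2n; case: (odd N) => /=; field.
  - by rewrite /parB oNk mR NE -mul2n; case: (odd N) => /=; field.
  - by rewrite /parC -mul2n; ring.
have -> : G mu1 mu2 mu3 N k.*2.+1 l = 0.
  rewrite -lE add0n; have [kj|jk] := ltnP k j; last by rewrite G_lt// ltnS leq_double.
  have -> : j.*2 = (k.*2.+1 + (j - k.+1).*2.+1)%N.
    by rewrite addnS -!addSn -doubleS -doubleD subnKC.
  by rewrite G_odd.
rewrite mulr0 addr0 coefZ -mulrA; congr (_ * _).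
set m := (n%:Z - _).
have mE : m = n%:Z - e%:Z by [].
case: m mE => m mE; last by rewrite /jacp /jacobi mulr0 coef0 mul0r.
rewrite coef_Xn_jacp; congr (_ * _).
have mR : m%:R = n%:R - e%:R :> R.
  have : (m%:Z + e%:Z = n%:Z)%R by rewrite mE; ring.
  by rewrite -!PoszD => -[<-]; rewrite !natrD; ring.
case: leqP => [kj|jk]; last by rewrite -lE add0n G_lt// ltn_double.
rewrite -/j in kj *.
have -> : l = (e.*2 + (j - e).*2)%N by rewrite -lE add0n -doubleD subnKC.
rewrite G_even.
have oNk : odd (N + e.*2) = odd N by rewrite oddD odd_double addbF.
congr (hyp _ _ _ _).
- by rewrite /parA oNk mR NE -mul2n; case: (odd N) => /=; field.
- by rewrite /parB oNk mR NE -mul2n; case: (odd N) => /=; field.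
- by rewrite /parC -mul2n; ring.
Qed.

Let a_gt0 : 0 < mu1 + 1 / 2. Proof. by move: hmu1; lra. Qed.
Let b_gt0 : 0 < mu2 + 1 / 2. Proof. by move: hmu2; lra. Qed.
Let s_gt0 : 0 < mu1 + mu2 + 1. Proof. by move: hmu1 hmu2; lra. Qed.

(** The square of [Fm] at pi / 2. Using [uphalf K], which is k + p, absorbs the factor raised to the
    power p into the Gamma values. *)
Definition normF K : R :=
  Gam (mu1 + mu2 + 1 + K./2%:R) * Gam (mu1 + 1 / 2 + (uphalf K)%:R)
  / (2 * K./2`!%:R * Gam (mu2 + 1 / 2 + (uphalf K)%:R) * Gam (mu1 + 1 / 2) ^+ 2).

Lemma Fm_pihalf K :
  0 < (-1) ^+ K./2 * Fm mu1 mu2 K (pi / 2)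
  /\ Fm mu1 mu2 K (pi / 2) ^+ 2 = normF K.
Proof.
have c2 : cos (2 * (pi / 2)) = -1 :> R by rewrite mulrC divfK ?pnatr_eq0// cospi.
rewrite /Fm /normF c2 cos_pihalf sin_pihalf jacobiN1; last by move: b_gt0; lra.
rewrite !(mulr0, mul0r) addr0 mulr1.
set k := K./2.
have -> : mu1 - 1 / 2 + 1 = mu1 + 1 / 2 by field.
rewrite pochE// uphalf_half -/k addnC.
have k0 := fact_natr_neq0 R k.
have G1 := Gam_neq0 k a_gt0; have G2 := Gam_neq0 k b_gt0.
have G3 := Gam_neq0 k s_gt0; have G4 := Gam_neq0 0 a_gt0.
rewrite addr0 in G4.
have zE : zetam mu1 mu2 K ^+ 2 = k`!%:R * Gam (mu1 + mu2 + 1 + k%:R)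
  / (2 * Gam (mu1 + 1 / 2 + k%:R) * Gam (mu2 + 1 / 2 + k%:R)).
  rewrite /zetam -/k !GamE.
  gamma_arg (mu1 + mu2 + 1 + k%:R); gamma_arg (mu1 + 1 / 2 + k%:R).
  gamma_arg (mu2 + 1 / 2 + k%:R).
  by rewrite sqr_sqrtr// divr_ge0// ?mulr_ge0// ltW// Gamn_gt0.
have z0 : 0 < zetam mu1 mu2 K.
  rewrite lt0r sqrtr_ge0 andbT -sqrf_eq0 zE; apply: lt0r_neq0.
  by rewrite divr_gt0 ?mulr_gt0 ?ltr0n ?fact_gt0// Gamn_gt0.
set z := zetam _ _ _ in zE z0 *.
have g1 : 0 < Gam (mu1 + 1 / 2 + k%:R) by rewrite Gamn_gt0.
have g4 : 0 < Gam (mu1 + 1 / 2) by rewrite Gam_gt0.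
have f0 : 0 < k`!%:R :> R by rewrite ltr0n fact_gt0.
have s1 : (-1) ^+ k * (-1) ^+ k = 1 :> R by rewrite -exprD addnn -mul2n exprM sqrrN !expr1n.
case: (boolP (odd K)) => oK; rewrite /= ?addn0 ?addn1; last first.
  rewrite mul0r powRr0; split.
    rewrite [ltRHS](_ : _ = (-1) ^+ k * (-1) ^+ k * z
      * (Gam (mu1 + 1 / 2 + k%:R) / Gam (mu1 + 1 / 2) / k`!%:R)); last by ring.
    by rewrite s1; positive.
  rewrite [LHS](_ : _ = ((-1) ^+ k * (-1) ^+ k) * z ^+ 2
      * (Gam (mu1 + 1 / 2 + k%:R) / Gam (mu1 + 1 / 2) / k`!%:R) ^+ 2); last by ring.
  rewrite s1 zE; field.
  by rewrite G1 G2 G4 k0.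
have x0 : 0 < k%:R + mu1 + 1 / 2 by have := ler0n R k; move: a_gt0; lra.
have y0 : 0 < k%:R + mu2 + 1 / 2 by have := ler0n R k; move: b_gt0; lra.
have [u [v [u0 v0 uE vE ->]]] := powR_half_ratio x0 y0.
split.
  rewrite [ltRHS](_ : _ = (-1) ^+ k * (-1) ^+ k * z * (u / v)
      * (Gam (mu1 + 1 / 2 + k%:R) / Gam (mu1 + 1 / 2) / k`!%:R)); last by ring.
  by rewrite s1; positive.
rewrite [LHS](_ : _ = ((-1) ^+ k * (-1) ^+ k) * z ^+ 2 * (u ^+ 2 / v ^+ 2)
      * (Gam (mu1 + 1 / 2 + k%:R) / Gam (mu1 + 1 / 2) / k`!%:R) ^+ 2); last first.
  by field; rewrite G4 k0 gt_eqF.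
rewrite s1 zE uE vE !GamSn//.
field.
have kn0 := ler0n R k; have b0 := b_gt0.
by nonzero.
Qed.

(** For odd K the quotient of the two zeta factors, the prefactors and the Jacobi values at -1
    combine to -1. Thus both terms of the restricted Y_K share the factor [Fm]. *)
Lemma Fp_pihalf K :
  Fp mu1 mu2 K (pi / 2) = (-1) ^+ K * Fm mu1 mu2 K (pi / 2).
Proof.
have c2 : cos (2 * (pi / 2)) = -1 :> R by rewrite mulrC divfK ?pnatr_eq0// cospi.
rewrite /Fp /Fm c2 cos_pihalf sin_pihalf !(mulr0, mul0r) subr0 addr0 mulr1.
rewrite -PoszD !jacobiN1; try by move: b_gt0; lra.
set k := K./2.
have -> : mu1 - 1 / 2 + 1 = mu1 + 1 / 2 by field.
rewrite -(signr_odd _ K) /zetap /zetam -/k; case: (boolP (odd K)) => oK; last first.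
  by rewrite expr0 !mul0r !powRr0 !addr0 addn0; ring.
have p0 := poch_gt0 k a_gt0.
have -> : true%:R = 1 :> R by [].
rewrite addn1 !GamE.
gamma_arg (mu1 + mu2 + 1 + k.+1%:R); gamma_arg (mu1 + 1 / 2 + k.+1%:R).
gamma_arg (mu2 + 1 / 2 + k.+1%:R); gamma_arg (mu1 + mu2 + 1 + k%:R).
gamma_arg (mu1 + 1 / 2 + k%:R); gamma_arg (mu2 + 1 / 2 + k%:R).
rewrite !GamSn// factS natrM pochS.
have kn0 := ler0n R k.
have x1 : 0 < k%:R + 1 :> R by lra.
have x2 : 0 < k%:R + mu1 + mu2 + 1 by move: s_gt0; lra.
have x3 : 0 < k%:R + mu1 + 1 / 2 by move: a_gt0; lra.
have x4 : 0 < k%:R + mu2 + 1 / 2 by move: b_gt0; lra.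
have [u1 [u2 [u10 u20 u1E u2E ->]]] := powR_half_ratio x1 x2.
have [u3 [u4 [u30 u40 u3E u4E ->]]] := powR_half_ratio x3 x4.
have g1 := Gamn_gt0 k s_gt0; have g2 := Gamn_gt0 k a_gt0; have g3 := Gamn_gt0 k b_gt0.
have f0 : 0 < k`!%:R :> R by rewrite ltr0n fact_gt0.
move: g1 g2 g3 f0 p0.
set A := Gam _; set B := Gam _; set C := Gam _; set f := k`!%:R; set p := poch _ _.
move=> A0 B0 C0 f0 p0.
have -> : k.+1%:R * f * ((mu1 + mu2 + 1 + k%:R) * A)
  / (2 * ((mu1 + 1 / 2 + k%:R) * B) * ((mu2 + 1 / 2 + k%:R) * C))
  = (u1 * u2 / (u3 * u4)) ^+ 2 * (f * A / (2 * B * C)).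
  rewrite expr_div_n !exprMn u1E u2E u3E u4E; field; nonzero.
rewrite sqrtrM ?sqr_ge0// sqrtr_sqr ger0_norm; last first.
  by rewrite divr_ge0 ?mulr_ge0// ltW.
have E : u1 ^+ 2 * (mu1 + 1 / 2 + k%:R) = k.+1%:R * u3 ^+ 2 by rewrite u1E u3E; ring.
set z := Num.sqrt _.
rewrite exprS.
transitivity (z * (-1) ^+ k * p / f * (u1 ^+ 2 * (mu1 + 1 / 2 + k%:R))
    / (u3 * u4) * (-1 / k.+1%:R)).
  by field; nonzero; rewrite ?gt_eqF.
rewrite E expr1; field; nonzero; rewrite ?gt_eqF//.
Qed.

End CoefficientsY.

(** A tuple of equations, used as a single rewriting rule for the Jacobi degrees. *)
Lemma natz_subE (k d : nat) :
  ((((k + d).+1%:Z - (k + 1)%N%:Z = d) * ((k + d).+1%:Z - k%:Z - 1 = d)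
    * ((k + d)%:Z - (k + 1)%N%:Z = d%:Z - 1) * ((k + d)%:Z - k%:Z - 1 = d%:Z - 1))
   * (((k + d)%:Z - (k + 0)%N%:Z = d) * ((k + d)%:Z - k%:Z = d)))%type.
Proof. by do ![split]; lia. Qed.

(** * Leading coefficients of the restricted Y_K *)

Section LowerUpper.
Variables (R : realType) (mu1 mu2 mu3 : R).
Hypotheses (hmu1 : - (1 / 2) < mu1) (hmu2 : - (1 / 2) < mu2)
  (hmu3 : - (1 / 2) < mu3).
Implicit Types (N K D n k d l : nat).

Let a_gt0 : 0 < mu1 + 1 / 2. Proof. by move: hmu1; lra. Qed.
Let b_gt0 : 0 < mu2 + 1 / 2. Proof. by move: hmu2; lra. Qed.
Let c_gt0 : 0 < mu3 + 1 / 2. Proof. by move: hmu3; lra. Qed.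
Let s_gt0 : 0 < mu1 + mu2 + 1. Proof. by move: hmu1 hmu2; lra. Qed.
Let t_gt0 : 0 < mu1 + mu2 + mu3 + 3 / 2. Proof. by move: hmu1 hmu2 hmu3; lra. Qed.

Local Notation cp := (Ycoefp mu1 mu2 mu3).
Local Notation cm := (Ycoefm mu1 mu2 mu3).
Local Notation s := (mu1 + mu2 + 1).
Local Notation t := (mu1 + mu2 + mu3 + 3 / 2).
Local Notation c := (mu3 + 1 / 2).

(* Of the two terms of Y_K, one starts with s^K and the other with s^K.+1;
   [lowY] and [highY] are the respective constants of [Ycoefp] and [Ycoefm]. *)
Definition lowY K D : R := if odd K then cm (K + D) K else cp (K + D) K.
Definition highY K D : R := if odd K then cp (K + D) K else cm (K + D) K.

(** The radicand of the normalisation of Y_K, with d = D./2; in these variables it is the same for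
    all parities of N and K. *)
Definition normc K d : R :=
  d`!%:R * Gam (t + (K + d)%:R) / (Gam (s + (K + d)%:R) * Gam (c + d%:R)).

Let normc_gt0 K d : 0 < normc K d.
Proof.
have h1 := Gamn_gt0 (K + d) t_gt0; have h2 := Gamn_gt0 (K + d) s_gt0.
have h3 := Gamn_gt0 d c_gt0.
have f0 : 0 < d`!%:R :> R by rewrite ltr0n fact_gt0.
by rewrite /normc; positive.
Qed.

Let nDk k d : (k + d)%:R + k%:R = (k.*2 + d)%:R :> R.
Proof. by rewrite -natrD addnAC addnn. Qed.

Let nBk k d : (k + d)%:R - k%:R = d%:R :> R.
Proof. by rewrite natrD addrAC subrr add0r. Qed.

Let nDkS k d : (k + d).+1%:R + k%:R = (k.*2 + d).+1%:R :> R.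
Proof. by rewrite -natrD addSn addnAC addnn. Qed.

Let nBkS k d : (k + d).+1%:R - k%:R = d%:R + 1 :> R.
Proof. by rewrite -natr1 addrAC nBk. Qed.

Let sgn_double k : (-1) ^+ k.*2 = 1 :> R.
Proof. by rewrite -signr_odd odd_double. Qed.

Ltac coef_simpl := rewrite /Ycoefp /Ycoefm /normc /= ?odd_double /=
  ?uphalf_double ?doubleK ?subn0 ?subn1 ?addSn /= ?addKn
  ?subr0 ?addr0 ?mul0r ?powRr0 ?mulr1 ?subrr ?mul0r ?powRr0 ?mulr1 !GamE.

(** In [coef_ee], [coef_eo], [coef_oe] and [coef_oo] the letters give the parities of N and then of
    K. A half-integer power survives only when they differ. *)
Lemma coef_ee k d : cp (k + d).*2 k.*2 = Num.sqrt (normc k.*2 d)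
  /\ cm (k + d).*2 k.*2 = Num.sqrt (normc k.*2 d).
Proof.
coef_simpl; rewrite nDk nBk.
gamma_arg (t + (k.*2 + d)%:R); gamma_arg (s + (k.*2 + d)%:R).
by gamma_arg (c + d%:R).
Qed.

Lemma coef_eo k d :
  let r := ((s + (k.*2.+1 + d)%:R) / (c + d%:R)) in
  cp (k + d).+1.*2 k.*2.+1 = Num.sqrt (normc k.*2.+1 d) * r^-1 `^ (1 / 2)
  /\ cm (k + d).+1.*2 k.*2.+1 = Num.sqrt (normc k.*2.+1 d) * r `^ (1 / 2).
Proof.
coef_simpl; rewrite nDkS nBkS -addnS addKn invf_div /=.
gamma_arg (t + (k.*2 + d).+1%:R); gamma_arg (s + (k.*2 + d).+1%:R).
gamma_arg (c + d%:R).
by split; congr (_ * (_ / _) `^ _); field.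
Qed.

Lemma coef_oe k d :
  let r := ((s + (k.*2 + d)%:R) / (c + d%:R)) in
  cp (k + d).*2.+1 k.*2 = Num.sqrt (normc k.*2 d) * r `^ (1 / 2)
  /\ cm (k + d).*2.+1 k.*2 = - (Num.sqrt (normc k.*2 d) * r^-1 `^ (1 / 2)).
Proof.
coef_simpl; rewrite nDk nBk sgn_double [1 * Num.sqrt _]mul1r invf_div.
gamma_arg (t + (k.*2 + d)%:R); gamma_arg (s + (k.*2 + d)%:R).
gamma_arg (c + d%:R); rewrite [Gam (c + _) * _]mulrC.
by split; last congr (- _); congr (_ * (_ / _) `^ _); field.
Qed.

Lemma coef_oo k d : cp (k + d).*2.+1 k.*2.+1 = - Num.sqrt (normc k.*2.+1 d)
  /\ cm (k + d).*2.+1 k.*2.+1 = Num.sqrt (normc k.*2.+1 d).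
Proof.
coef_simpl; rewrite nDk nBk exprS sgn_double mulr1 mulN1r opprK.
gamma_arg (t + (k.*2 + d).+1%:R); gamma_arg (s + (k.*2 + d).+1%:R).
by gamma_arg (c + d%:R); rewrite [Gam (c + _) * _]mulrC.
Qed.

Lemma lowY_highY K D : let d := D./2 in
  [/\ 0 < lowY K D,
   lowY K D ^+ 2 = normc K d * (if odd D then (s + (K + d)%:R) / (c + d%:R) else 1)
   & highY K D = (-1) ^+ (K + D) * lowY K D
       * (if odd D then (c + d%:R) / (s + (K + d)%:R) else 1)].
Proof.
move=> d; rewrite /lowY /highY.
have sp n : 0 < s + n%:R by rewrite ltr_wpDr.
have cpos n : 0 < c + n%:R by rewrite ltr_wpDr.
have := odd_double_half K; have := odd_double_half D; rewrite -/d.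
clearbody d; set k := K./2; move: k => k.
have b0 := normc_gt0 K d.
have sb : Num.sqrt (normc K d) ^+ 2 = normc K d by rewrite sqr_sqrtr// ltW.
have sb0 : 0 < Num.sqrt (normc K d) by rewrite sqrtr_gt0.
have [u [v [u0 v0 uE vE rE]]] := powR_half_ratio (sp (K + d)%N) (cpos d).
have [v' [u' [v0' u0' vE' uE' rE']]] := powR_half_ratio (cpos d) (sp (K + d)%N).
have uu : u' = u by apply/eqP; rewrite -(@eqrXn2 _ 2%N)// ?ltW// uE uE'.
have vv : v' = v by apply/eqP; rewrite -(@eqrXn2 _ 2%N)// ?ltW// vE vE'.
rewrite {}uu {}vv in rE'; clear u' v' vE' uE' u0' v0'.
rewrite -(signr_odd _ (K + D)).
case oD: (odd D); case oK: (odd K); rewrite ?add0n ?add1n => DE KE;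
  rewrite oddD oD oK /= ?expr0 ?expr1.
- have -> : (K + D)%N = (k + d).+1.*2 by rewrite -KE -DE addSn addnS -doubleD -doubleS.
  have /= := coef_eo k d; rewrite KE invf_div rE rE' -uE -vE => -[-> ->].
  split; first by positive.
    by rewrite exprMn sb expr_div_n.
  by field; rewrite !gt_eqF.
- have -> : (K + D)%N = (k + d).*2.+1 by rewrite -KE -DE addnS -doubleD.
  have /= := coef_oe k d; rewrite KE invf_div rE rE' -uE -vE => -[-> ->].
  split; first by positive.
    by rewrite exprMn sb expr_div_n.
  by field; rewrite !gt_eqF.
- have -> : (K + D)%N = (k + d).*2.+1 by rewrite -KE -DE addSn -doubleD.
  have := coef_oo k d; rewrite KE => -[-> ->].
  by split; rewrite ?sb ?mulr1// mulN1r.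
have -> : (K + D)%N = (k + d).*2 by rewrite -KE -DE -doubleD.
have := coef_ee k d; rewrite KE => -[-> ->].
by split; rewrite ?sb ?mulr1// mul1r.
Qed.

(* The coefficient of s^K in Y_K at phi = pi / 2. *)
Definition leadY K D : R :=
  lowY K D * Fm mu1 mu2 K (pi / 2) * (poch (s + K%:R) D./2 / D./2`!%:R).

Let jacobi1_pred d (x y z : R) : 0 < x + 1 ->
  jacobi (d%:Z - 1) (x + 1) y 1 = jacobi d x z 1 * (d%:R / (x + 1)).
Proof.
move=> x0; case: d => [|d]; first by rewrite !mul0r mulr0.
have -> : d.+1%:Z - 1 = d by lia.
rewrite !jacobi1 pochSl factS natrM; have d0 := ler0n R d; have f0 := fact_natr_neq0 R d.
by field; nonzero.
Qed.

Let jacobi1_succ d (x y z : R) : 0 < x + 1 ->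
  jacobi d (x + 1) y 1 = jacobi d x z 1 * ((x + 1 + d%:R) / (x + 1)).
Proof.
move=> x0; rewrite !jacobi1; have f0 := fact_natr_neq0 R d.
have -> : poch (x + 1 + 1) d = poch (x + 1) d * (x + 1 + d%:R) / (x + 1).
  by rewrite -poch_shift; field; nonzero.
by field; nonzero.
Qed.

Let jacobi1b d (x y z : R) : jacobi d x y 1 = jacobi d x z 1.
Proof. by rewrite !jacobi1. Qed.

(** The quotient of [highY] and [lowY], times that of the Jacobi values at 1 and the sign from
    [Fp_pihalf], is [tau]. *)
Lemma Y_interleave K D l :
  interleave (Y_poly mu1 mu2 mu3 (K + D) K).1 (Y_poly mu1 mu2 mu3 (K + D) K).2 l
  = leadY K D * Yh mu1 mu2 mu3 (K + D) K l.
Proof.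
rewrite /Y_poly /Yjacp /Yjacm /=.
have -> : (K + D)./2%:Z - K./2%:Z - (odd K)%:Z = (K + D)./2%:Z - (K./2 + odd K)%:Z.
  by rewrite PoszD opprD addrA.
have -> : 2 * K./2%:R + 2 * (odd K)%:R + mu1 + mu2 = 2 * (K./2 + odd K)%:R + mu1 + mu2.
  by rewrite natrD; ring.
rewrite interleave_jacp// Fp_pihalf// /leadY /Yh.
have [_ _] := lowY_highY K D; set d := D./2.
have sK : 0 < s + K%:R by rewrite ltr_wpDr.
have sKd : 0 < s + (K + d)%:R by rewrite ltr_wpDr.
have KR : K%:R = 2 * K./2%:R + (odd K)%:R :> R.
  by rewrite -{1}(odd_double_half K) -mul2n natrD natrM addrC.
have DR : D%:R = 2 * d%:R + (odd D)%:R :> R.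
  by rewrite -{1}(odd_double_half D) -mul2n natrD natrM addrC.
have -> : s + K%:R = (K%:R + mu1 + mu2) + 1 by ring.
rewrite -[_ / d`!%:R](@jacobi1 _ d _ 0).
have x0 : 0 < K%:R + mu1 + mu2 + 1 by move: sK; rewrite -!addrA addrC -!addrA; lra.
rewrite /lowY /highY /tau /parC -(signr_odd _ (K + D)) -(signr_odd _ K).
have oKK : odd (K + D + K) = odd D by rewrite addnAC oddD addnn odd_double.
have natrKD : (K + d)%:R = K%:R + d%:R :> R by rewrite natrD.
have KE := odd_double_half K; have DE := odd_double_half D; rewrite -/d in DE.
move: KE; set k := K./2 in KR * => KE.
rewrite !oKK !oddD !natrD DR.
case oK : (odd K) KE KR;
  case oD: (odd D) DE DR => DE DR KE KR; rewrite /= ?expr0 ?expr1 => hU; rewrite /= in KR.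
- have -> : (K + D)./2 = (k + d).+1.
    by rewrite -KE -DE !add1n addSn addnS -doubleD /= doubleK.
  have -> : (k + 1).*2 = K.+1 by rewrite -KE addn1 add1n doubleS.
  have -> : k.*2.+1 = K by rewrite -KE add1n.
  have -> : 2 * (k%:R + 1) + mu1 + mu2 = K%:R + mu1 + mu2 + 1 by rewrite KR; ring.
  have -> : 2 * k%:R + 1 + mu1 + mu2 = K%:R + mu1 + mu2 by rewrite KR.
  rewrite ?natz_subE (jacobi1_succ _ _ 0)// (@jacobi1b _ _ _ 0) hU.
  by have := sKd; rewrite natrKD => sKd'; field; nonzero.
- have -> : (K + D)./2 = (k + d)%N.
    by rewrite -KE -DE add1n add0n addSn -doubleD /= uphalf_double.
  have -> : (k + 1).*2 = K.+1 by rewrite -KE addn1 add1n doubleS.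
  have -> : k.*2.+1 = K by rewrite -KE add1n.
  have -> : 2 * (k%:R + 1) + mu1 + mu2 = K%:R + mu1 + mu2 + 1 by rewrite KR; ring.
  have -> : 2 * k%:R + 1 + mu1 + mu2 = K%:R + mu1 + mu2 by rewrite KR.
  rewrite ?natz_subE (jacobi1_pred _ _ 0)// (@jacobi1b _ _ _ 0) hU.
  by field; nonzero.
- have -> : (K + D)./2 = (k + d)%N.
    by rewrite -KE -DE add1n add0n addnS -doubleD /= uphalf_double.
  have -> : (k + 0).*2 = K by rewrite -KE addn0 add0n.
  have -> : k.*2.+1 = K.+1 by rewrite -KE add0n.
  have -> : 2 * (k%:R + 0) + mu1 + mu2 = K%:R + mu1 + mu2 by rewrite KR; ring.
  have -> : 2 * k%:R + 1 + mu1 + mu2 = K%:R + mu1 + mu2 + 1 by rewrite KR; ring.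
  rewrite ?natz_subE (jacobi1_succ _ _ 0)// (@jacobi1b _ _ _ 0) hU.
  by have := sKd; rewrite natrKD => sKd'; field; nonzero.
have -> : (K + D)./2 = (k + d)%N.
  by rewrite -KE -DE !add0n -doubleD doubleK.
have -> : (k + 0).*2 = K by rewrite -KE addn0 add0n.
have -> : k.*2.+1 = K.+1 by rewrite -KE add0n.
have -> : 2 * (k%:R + 0) + mu1 + mu2 = K%:R + mu1 + mu2 by rewrite KR; ring.
have -> : 2 * k%:R + 1 + mu1 + mu2 = K%:R + mu1 + mu2 + 1 by rewrite KR; ring.
rewrite ?natz_subE (jacobi1_pred _ _ 0)// (@jacobi1b _ _ _ 0) hU.
by field; nonzero.
Qed.

End LowerUpper.

(** * Normalisation constants *)

Section Norms.
Variables (R : realType) (mu1 mu2 mu3 : R).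
Hypotheses (hmu1 : - (1 / 2) < mu1) (hmu2 : - (1 / 2) < mu2)
  (hmu3 : - (1 / 2) < mu3).
Implicit Types (N K D n k d l : nat).

Let a_gt0 : 0 < mu1 + 1 / 2. Proof. by move: hmu1; lra. Qed.
Let b_gt0 : 0 < mu2 + 1 / 2. Proof. by move: hmu2; lra. Qed.
Let c_gt0 : 0 < mu3 + 1 / 2. Proof. by move: hmu3; lra. Qed.
Let s_gt0 : 0 < mu1 + mu2 + 1. Proof. by move: hmu1 hmu2; lra. Qed.
Let t_gt0 : 0 < mu1 + mu2 + mu3 + 3 / 2. Proof. by move: hmu1 hmu2 hmu3; lra. Qed.

Local Notation s := (mu1 + mu2 + 1).
Local Notation t := (mu1 + mu2 + mu3 + 3 / 2).
Local Notation c := (mu3 + 1 / 2).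

Lemma leadY_gt0 K D : 0 < (-1) ^+ K./2 * leadY mu1 mu2 mu3 K D.
Proof.
have [l0 _ _] := lowY_highY hmu1 hmu2 hmu3 K D.
have [F0 _] := Fm_pihalf hmu1 hmu2 K.
have sK : 0 < s + K%:R by rewrite ltr_wpDr.
have p0 := poch_gt0 D./2 sK.
have f0 : 0 < D./2`!%:R :> R by rewrite ltr0n fact_gt0.
rewrite /leadY mulrCA mulrAC [X in X * _]mulrA mulrC -mulrA mulrA mulrC.
rewrite [ltRHS](_ : _ = lowY mu1 mu2 mu3 K D * ((-1) ^+ K./2 * Fm mu1 mu2 K (pi / 2))
  * (poch (s + K%:R) D./2 / D./2`!%:R)); last by ring.
by positive.
Qed.

Lemma leadY_sqr K D : let d := D./2 in
  leadY mu1 mu2 mu3 K D ^+ 2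
  = normc mu1 mu2 mu3 K d * (if odd D then (s + (K + d)%:R) / (c + d%:R) else 1)
    * normF mu1 mu2 K * (Gam (s + (K + d)%:R) / (Gam (s + K%:R) * d`!%:R)) ^+ 2.
Proof.
move=> d.
have [_ <- _] := lowY_highY hmu1 hmu2 hmu3 K D.
have [_ <-] := Fm_pihalf hmu1 hmu2 K.
have sK : 0 < s + K%:R by rewrite ltr_wpDr.
rewrite /leadY pochE// -/d natrD [s + (K%:R + d%:R)]addrA.
have g0 := Gam_neq0 K s_gt0; have f0 := fact_natr_neq0 R d.
by field; nonzero.
Qed.

Lemma normF_step K : normF mu1 mu2 K.+1 = normF mu1 mu2 K *
  (if odd K then (s + K./2%:R) / (K./2%:R + 1)
   else (mu1 + 1 / 2 + K./2%:R) / (mu2 + 1 / 2 + K./2%:R)).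
Proof.
have g1 := Gam_neq0 K./2 s_gt0; have g2 := Gam_neq0 K./2 a_gt0.
have g3 := Gam_neq0 K./2 b_gt0; have g4 := Gam_neq0 0 a_gt0; rewrite addr0 in g4.
have f0 := fact_natr_neq0 R K./2; have k0 := ler0n R K./2; have b0 := b_gt0; have a0 := a_gt0.
rewrite /normF /= uphalf_half; case: (odd K); rewrite ?add1n ?add0n !GamSn// ?factS ?natrM
  -?[_./2.+1%:R]natr1.
  by field; nonzero.
by field; nonzero.
Qed.

Lemma leadY_step K D : let d : R := D./2%:R in
  leadY mu1 mu2 mu3 K.+1 D ^+ 2 = leadY mu1 mu2 mu3 K D.+1 ^+ 2 *
  ((if odd D then (s + K%:R + 1 + d) * (d + 1) else (t + K%:R + d) * (c + d))
     / (s + K%:R) ^+ 2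
   * (if odd K then (s + K./2%:R) / (K./2%:R + 1)
      else (mu1 + 1 / 2 + K./2%:R) / (mu2 + 1 / 2 + K./2%:R))).
Proof.
cbv zeta; rewrite !leadY_sqr normF_step /normc /= uphalf_half.
set u := (if odd K then _ else _); set F := normF _ _ _; set d := D./2.
have d0 := ler0n R d; have K0 := ler0n R K.
have g1 := Gam_neq0 (K + d) t_gt0; have g2 := Gam_neq0 (K + d) s_gt0.
have g3 := Gam_neq0 K s_gt0; have g4 := Gam_neq0 d c_gt0; have f0 := fact_natr_neq0 R d.
have s0 := s_gt0; have c0 := c_gt0; have t0 := t_gt0.
case: (odd D); rewrite ?add1n ?add0n /= ?addSn ?addnS !GamSn// ?factS ?natrM
  -?[d.+1%:R]natr1 -?[(_ + _).+1%:R]natr1 natrD;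
  rewrite natrD in g1 g2.
  by field; nonzero.
by field; nonzero.
Qed.

Lemma leadY0_sqr D : let d := D./2 in
  leadY mu1 mu2 mu3 0 D ^+ 2
  = Gam (t + d%:R) / (2 * d`!%:R * Gam (mu1 + 1 / 2) * Gam (mu2 + 1 / 2) * Gam c)
    * (poch s d / poch c d * (if odd D then (s + d%:R) / (c + d%:R) else 1)).
Proof.
move=> d; rewrite leadY_sqr -/d /normc /normF /= !add0n !pochE//; set f := (if _ then _ else _).
have g1 := Gam_neq0 d s_gt0; have g2 := Gam_neq0 d c_gt0; have f0 := fact_natr_neq0 R d.
have g3 := Gam_neq0 0 s_gt0; have g4 := Gam_neq0 0 c_gt0.
have g5 := Gam_neq0 0 a_gt0; have g6 := Gam_neq0 0 b_gt0.
rewrite !addr0 in g3 g4 g5 g6; rewrite !addr0 fact0 mulr1.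
by field; nonzero.
Qed.

(** Equivalently, the tridiagonal matrix is symmetric with respect to the normalised Y_K. By
    [leadY_step] it is a rational identity, checked for each parity of K and D. *)
Lemma leadY_ratio K D :
  let mu : R := (-1) ^+ (K + D.+1) * ((K + D.+1)%:R + 1 + mu1 + mu2 + mu3) in
  let rho1 := (mu2 + mu3) / 2 in
  let rho2 := (mu1 + mu) / 2 in
  let r1 := (mu3 - mu2) / 2 in
  let r2 := (mu - mu1) / 2 in
  (leadY mu1 mu2 mu3 K.+1 D * (lowc mu2 K.+1 / 2)) ^+ 2
  = BI_u rho1 rho2 r1 r2 K.+1 * leadY mu1 mu2 mu3 K D.+1 ^+ 2.
Proof.
cbv zeta; rewrite exprMn leadY_step mulrC [RHS]mulrC mulrCA; congr (_ * _).
rewrite /BI_u /BI_A /BI_C /lowc -(signr_odd _ (K + D.+1)) !(oddD, oddS) succnK natrD.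
have k0 := ler0n R K./2; have d0 := ler0n R D./2.
have KR : K%:R = (odd K)%:R + 2 * K./2%:R :> R.
  by rewrite -{1}(odd_double_half K) -mul2n natrD natrM.
have DR : D%:R = (odd D)%:R + 2 * D./2%:R :> R.
  by rewrite -{1}(odd_double_half D) -mul2n natrD natrM.
have h1 := a_gt0; have h2 := b_gt0; have h3 := c_gt0.
rewrite -[K.+1%:R]natr1 -[D.+1%:R]natr1 KR DR.
by case: (odd D); case: (odd K); rewrite /= ?expr0 ?expr1; field; nonzero.
Qed.

(** Splits the phase into its two sources: [D + D./2] from [northE] and [S./2] from [Fm_pihalf]. *)
Lemma Z_phaseE S D : Z_phase R (S + D) S = (-1) ^+ (D + D./2 + S./2).
Proof.
rewrite /Z_phase -signr_odd -[RHS]signr_odd; congr (_ ^+ nat_of_bool _).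
rewrite uphalf_half !(oddD, oddM) halfD !oddD.
case: (odd S); case: (odd D); case: (odd S./2); case: (odd D./2) => //.
Qed.

(* The value of Z_S at the north pole (0, 0, 1), for the parameters
   (mu2, mu3, mu1) of the ambient Z_S. *)
Definition north S D : R := Yfun mu1 mu2 mu3 (S + D) S (pi / 2) (pi / 2).

(** The Jacobi value at -1 contributes [(-1) ^+ d]. For odd D the surviving term is the one with
    [highY], whence the quotient and one more sign. *)
Lemma northE S D : let d := D./2 in
  north S D = (-1) ^+ (D + d)
    * (lowY mu1 mu2 mu3 S D * (if odd D then (c + d%:R) / (s + (S + d)%:R) else 1)
       * (poch c d / d`!%:R)) * Fm mu1 mu2 S (pi / 2).
Proof.
move=> d; have [_ _] := lowY_highY hmu1 hmu2 hmu3 S D; rewrite -/d.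
rewrite /lowY /highY /north Yfun_equator Fp_pihalf// /Yjacp /Yjacm /=.
have SE := odd_double_half S; have DE := odd_double_half D; rewrite -/d in DE.
rewrite -(signr_odd _ (S + D)) exprD -(signr_odd _ D) -(signr_odd _ S).
set k := S./2 in SE *; have k0 := ler0n R k.
have a1 : -1 < 2 * k%:R + 1 + mu1 + mu2 by move: s_gt0; lra.
have -> : c = mu3 - 1 / 2 + 1 by field.
have jacd (x : R) : -1 < x -> jacobi d x (mu3 - 1 / 2) (-1)
  = (-1) ^+ d * poch (mu3 - 1 / 2 + 1) d / d`!%:R by exact: jacobiN1.
clearbody d k; rewrite !oddD.
case oS: (odd S) SE; case oD: (odd D) DE => DE SE;
  rewrite /= ?expr0 ?expr1 ?natrD ?mulr0 ?mulr1 ?addr0.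
- have -> : (S + D)./2 = (k + d).+1.
    by rewrite -SE -DE !add1n addSn addnS -doubleD /= doubleK.
  rewrite natz_subE.
  rewrite jacd; last by move: a1; lra.
  by move=> ->; ring.
- have -> : (S + D)./2 = (k + d)%N.
    by rewrite -SE -DE add1n add0n addSn -doubleD /= uphalf_double.
  rewrite natz_subE.
  rewrite jacd//.
  by move=> _; ring.
- have -> : (S + D)./2 = (k + d)%N.
    by rewrite -SE -DE add1n add0n addnS -doubleD /= uphalf_double.
  rewrite natz_subE.
  rewrite jacd//.
  by move=> ->; ring.
have -> : (S + D)./2 = (k + d)%N.
  by rewrite -SE -DE !add0n -doubleD doubleK.
rewrite natz_subE.
rewrite jacd; last by move: s_gt0; lra.
by move=> _; ring.
Qed.

Lemma north_gt0 S D : 0 < Z_phase R (S + D) S * north S D.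
Proof.
have [l0 _ _] := lowY_highY hmu1 hmu2 hmu3 S D.
have [F0 _] := Fm_pihalf hmu1 hmu2 S.
rewrite Z_phaseE northE exprD; set d := D./2; set e := (-1) ^+ (D + d).
have e1 : e * e = 1 by rewrite /e -exprD addnn -signr_odd odd_double.
rewrite [ltRHS](_ : _ = e * e * ((-1) ^+ S./2 * Fm mu1 mu2 S (pi / 2)) *
   (lowY mu1 mu2 mu3 S D * (if odd D then (c + d%:R) / (s + (S + d)%:R) else 1)
       * (poch c d / d`!%:R))); last by ring.
have p0 := poch_gt0 d c_gt0.
have f0 : 0 < d`!%:R :> R by rewrite ltr0n fact_gt0.
have s0 : 0 < s + (S + d)%:R by rewrite ltr_wpDr.
have c0 : 0 < c + d%:R by rewrite ltr_wpDr.
by rewrite e1; case: odd; positive.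
Qed.

Lemma north_sqr S D : let d := D./2 in
  north S D ^+ 2 = normc mu1 mu2 mu3 S d
    * (if odd D then (c + d%:R) / (s + (S + d)%:R) else 1)
    * (Gam (c + d%:R) / (Gam c * d`!%:R)) ^+ 2 * normF mu1 mu2 S.
Proof.
move=> d; rewrite northE -/d.
have [_] := lowY_highY hmu1 hmu2 hmu3 S D; rewrite -/d => + _.
have [_] := Fm_pihalf hmu1 hmu2 S.
move: (Fm _ _ _ _) (normF _ _ _) (lowY _ _ _ _ _) (normc _ _ _ _ _) => F nF L nL <-.
rewrite !exprMn => ->.
rewrite -!exprM [((D + d) * 2)%N]mulnC exprM sqrrN !expr1n mul1r pochE//.
have s0 : 0 < s + (S + d)%:R by rewrite ltr_wpDr.
have c0 : 0 < c + d%:R by rewrite ltr_wpDr.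
have g0 := Gam_neq0 0 c_gt0; rewrite addr0 in g0.
have f0 := fact_natr_neq0 R d.
by case: odd; field; nonzero; rewrite ?gt_eqF.
Qed.

Lemma north_step S D : let d : R := D./2%:R in
  north S.+1 D ^+ 2 = north S D.+1 ^+ 2 *
  ((if odd D then (d + 1) / (s + S%:R + 1 + d) else (t + S%:R + d) / (c + d))
   * (if odd S then (s + S./2%:R) / (S./2%:R + 1)
      else (mu1 + 1 / 2 + S./2%:R) / (mu2 + 1 / 2 + S./2%:R))).
Proof.
cbv zeta; rewrite !north_sqr normF_step /normc /= uphalf_half.
set u := (if odd S then _ else _); set F := normF _ _ _; set d := D./2.
have d0 := ler0n R d; have S0 := ler0n R S.
have g1 := Gam_neq0 (S + d) t_gt0; have g2 := Gam_neq0 (S + d) s_gt0.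
have g3 := Gam_neq0 0 c_gt0; rewrite addr0 in g3.
have g4 := Gam_neq0 d c_gt0; have f0 := fact_natr_neq0 R d.
have s0 := s_gt0; have c0 := c_gt0; have t0 := t_gt0.
case: (odd D); rewrite ?add1n ?add0n /= ?addSn ?addnS !GamSn// ?factS ?natrM
  -?[d.+1%:R]natr1 -?[(_ + _).+1%:R]natr1 natrD;
  rewrite natrD in g1 g2.
  by field; nonzero.
by field; nonzero.
Qed.

Lemma north0_sqr D : let d := D./2 in
  north 0 D ^+ 2
  = Gam (t + d%:R) / (2 * d`!%:R * Gam (mu1 + 1 / 2) * Gam (mu2 + 1 / 2) * Gam c)
    * (poch c d / poch s d * (if odd D then (c + d%:R) / (s + d%:R) else 1)).
Proof.
move=> d; rewrite north_sqr -/d /normc /normF /= !add0n !pochE//; set f := (if _ then _ else _).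
have g1 := Gam_neq0 d s_gt0; have g2 := Gam_neq0 d c_gt0; have f0 := fact_natr_neq0 R d.
have g3 := Gam_neq0 0 s_gt0; have g4 := Gam_neq0 0 c_gt0.
have g5 := Gam_neq0 0 a_gt0; have g6 := Gam_neq0 0 b_gt0.
rewrite !addr0 in g3 g4 g5 g6; rewrite !addr0 fact0 mulr1.
by field; nonzero.
Qed.

End Norms.

(** * Identification of the weight *)

Section Weight.
Variables (R : realType) (mu1 mu2 mu3 : R).
Hypotheses (hmu1 : - (1 / 2) < mu1) (hmu2 : - (1 / 2) < mu2)
  (hmu3 : - (1 / 2) < mu3).
Implicit Types (N S D : nat).

Let mu N : R := (-1) ^+ N * (N%:R + 1 + mu1 + mu2 + mu3).
Let rho1 : R := (mu2 + mu3) / 2.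
Let rho2 N : R := (mu1 + mu N) / 2.
Let r1 : R := (mu3 - mu2) / 2.
Let r2 N : R := (mu N - mu1) / 2.

Let w N S := w_weight rho1 (rho2 N) r1 (r2 N) N S.

Let a_gt0 : 0 < mu1 + 1 / 2. Proof. by move: hmu1; lra. Qed.
Let b_gt0 : 0 < mu2 + 1 / 2. Proof. by move: hmu2; lra. Qed.
Let c_gt0 : 0 < mu3 + 1 / 2. Proof. by move: hmu3; lra. Qed.
Let s_gt0 : 0 < mu2 + mu3 + 1. Proof. by move: hmu2 hmu3; lra. Qed.

(** From even to odd S only the symbols of length l + nu grow, from odd to even only those of length
    l; the sign changes each time. *)
Lemma weightS N S : let l : R := S./2%:R in w N S.+1 = w N S *
  (if odd S then
    - ((rho1 + rho2 N + 1 + l) * (2 * rho1 + 1 + l)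
       / ((1 + l) * (rho1 - rho2 N + 1 + l)))
   else
    - ((rho1 - r1 + 1 / 2 + l) * (rho1 - r2 N + 1 / 2 + l)
       / ((rho1 + r1 + 1 / 2 + l) * (rho1 + r2 N + 1 / 2 + l)))).
Proof.
rewrite /w /w_weight /poch2 /= uphalf_half.
case: (odd S); rewrite /= ?addn0 ?addn1 ?add1n ?add0n ?addn0 ?pochS ?expr0 ?expr1 !invfM; ring.
Qed.

Lemma north_ratio S D : let l : R := S./2%:R in let N := (S + D.+1)%N in
  north mu2 mu3 mu1 S.+1 D ^+ 2 = north mu2 mu3 mu1 S D.+1 ^+ 2 *
  (if odd S then
    - ((rho1 + rho2 N + 1 + l) * (2 * rho1 + 1 + l)
       / ((1 + l) * (rho1 - rho2 N + 1 + l)))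
   else
    - ((rho1 - r1 + 1 / 2 + l) * (rho1 - r2 N + 1 / 2 + l)
       / ((rho1 + r1 + 1 / 2 + l) * (rho1 + r2 N + 1 / 2 + l)))).
Proof.
rewrite north_step//; cbv zeta; congr (_ * _).
rewrite /rho1 /rho2 /r1 /r2 /mu -(signr_odd _ (S + D.+1)) !(oddD, oddS) natrD.
have k0 := ler0n R S./2; have d0 := ler0n R D./2.
have SR : S%:R = (odd S)%:R + 2 * S./2%:R :> R.
  by rewrite -{1}(odd_double_half S) -mul2n natrD natrM.
have DR : D%:R = (odd D)%:R + 2 * D./2%:R :> R.
  by rewrite -{1}(odd_double_half D) -mul2n natrD natrM.
have h1 := a_gt0; have h2 := b_gt0; have h3 := c_gt0.
rewrite -[D.+1%:R]natr1 SR DR.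
by case: (odd D); case: (odd S); rewrite /= ?expr0 ?expr1; field; nonzero.
Qed.

(** Induction on S with D free, so that N = S + D stays fixed. The base case S = 0 identifies
    h_N. *)
Lemma weight_north S D :
  leadY mu1 mu2 mu3 0 (S + D) ^+ 2 * w (S + D) S = north mu2 mu3 mu1 S D ^+ 2.
Proof.
elim: S D => [|S IH] D; last first.
  by rewrite north_ratio addSnnS weightS mulrA IH.
rewrite add0n north0_sqr// leadY0_sqr//; set d := D./2.
have e1 : 2 * rho1 + 1 = mu2 + mu3 + 1 by rewrite /rho1; field.
have e2 : rho1 + r1 + 1 / 2 = mu3 + 1 / 2 by rewrite /rho1 /r1; field.
have DR : D%:R = (odd D)%:R + 2 * d%:R :> R.
  by rewrite -{1}(odd_double_half D) -mul2n natrD natrM.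
have muE : mu D = (-1) ^+ odd D * ((odd D)%:R + 2 * d%:R + 1 + mu1 + mu2 + mu3).
  by rewrite /mu DR signr_odd.
have s0 : 0 < mu1 + mu2 + 1 by move: hmu1 hmu2; lra.
have p1 := poch_neq0 d s0; have p2 := poch_neq0 d s_gt0.
have p3 := poch_neq0 d a_gt0; have p4 := poch_neq0 d c_gt0.
have h1 := a_gt0; have h2 := s_gt0; have h3 := c_gt0; have d0 := ler0n R d.
have sg n : (-1) ^+ n != 0 :> R by rewrite signr_eq0.
rewrite [mu2 + mu3 + mu1 + 3 / 2](_ : _ = mu1 + mu2 + mu3 + 3 / 2); last by ring.
rewrite [RHS](_ : _ = Gam (mu1 + mu2 + mu3 + 3 / 2 + d%:R)
    / (2 * d`!%:R * Gam (mu1 + 1 / 2) * Gam (mu2 + 1 / 2) * Gam (mu3 + 1 / 2))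
  * (poch (mu1 + 1 / 2) d / poch (mu2 + mu3 + 1) d
     * (if odd D then (mu1 + 1 / 2 + d%:R) / (mu2 + mu3 + 1 + d%:R) else 1))); last first.
  by congr (_ / _ * _); ring.
rewrite -[LHS]mulrA; congr (_ * _).
rewrite /w /w_weight /h_norm /poch2 /= !poch0 uphalf_half -/d e1 e2.
case oD: (odd D) muE => muE; rewrite /= ?expr0 ?expr1 in muE *.
  rewrite add1n.
  (* Since mu is -(N + 1 + mu1 + mu2 + mu3) with N = 2d + 1, two symbols of length d + 1 reverse by
     [poch_opp] and their signs cancel. *)
  have -> : r1 + r2 D = 1 - (mu1 + mu2 + 1) - d.+1%:R.
    by rewrite /r1 /r2 muE -[d.+1%:R]natr1; field.
  have -> : rho1 + r2 D + 1 / 2 = 1 - (mu1 + 1 / 2) - d.+1%:R.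
    by rewrite /rho1 /r2 muE -[d.+1%:R]natr1; field.
  rewrite !poch_opp !pochS; move: (sg d.+1); set e := (-1) ^+ d.+1 => e0.
  by field; nonzero.
have -> : rho1 - rho2 D + 1 = 1 - (mu1 + 1 / 2) - d%:R.
  by rewrite /rho1 /rho2 muE; field.
have -> : r1 - rho2 D + 1 / 2 = 1 - (mu1 + mu2 + 1) - d%:R.
  by rewrite /r1 /rho2 muE; field.
rewrite !poch_opp; move: (sg d); set e := (-1) ^+ d => e0.
by field; nonzero.
Qed.

End Weight.

(** * The connection coefficients *)

Section Assembly.
Variables (R : realType) (mu1 mu2 mu3 : R).
Hypotheses (hmu1 : - (1 / 2) < mu1) (hmu2 : - (1 / 2) < mu2)
  (hmu3 : - (1 / 2) < mu3).
Implicit Types (N S K D : nat).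

Let mu N : R := (-1) ^+ N * (N%:R + 1 + mu1 + mu2 + mu3).
Let rho1 : R := (mu2 + mu3) / 2.
Let rho2 N : R := (mu1 + mu N) / 2.
Let r1 : R := (mu3 - mu2) / 2.
Let r2 N : R := (mu N - mu1) / 2.
Let U N K := \prod_(1 <= i < K.+1) BI_u rho1 (rho2 N) r1 (r2 N) i.
Let P K : R := \prod_(1 <= i < K.+1) (lowc mu2 i / 2).

(** [lowc] is negative at positive even indices and positive at odd ones. *)
Lemma prod_lowc_gt0 K : 0 < (-1) ^+ K./2 * P K.
Proof.
elim: K => [|K IH]; first by rewrite /P big_geq// mulr1.
rewrite /P big_nat_recr//= -/(P K) uphalf_half exprD [_ ^+ odd K * _]mulrC mulrACA mulr_gt0//.
rewrite /lowc /=; case: (odd K); rewrite /= ?expr0 ?expr1.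
  by have := ler0n R K; rewrite -[K.+1%:R]natr1; lra.
by have := ler0n R K; move: hmu2; rewrite -[K.+1%:R]natr1; lra.
Qed.

Lemma leadY_prod_gt0 K D : 0 < leadY mu1 mu2 mu3 K D * P K.
Proof.
have e1 : (-1) ^+ K./2 * (-1) ^+ K./2 = 1 :> R.
  by rewrite -exprD addnn -signr_odd odd_double.
rewrite -[ltRHS]mul1r -e1 mulrACA mulr_gt0 ?prod_lowc_gt0//.
exact: leadY_gt0.
Qed.

Lemma leadY_prod_sqr K D :
  (leadY mu1 mu2 mu3 K D * P K) ^+ 2 = leadY mu1 mu2 mu3 0 (K + D) ^+ 2 * U (K + D) K.
Proof.
elim: K D => [|K IH] D; first by rewrite /P /U !big_geq// mulr1 mulr1.
have PS : P K.+1 = P K * (lowc mu2 K.+1 / 2) by rewrite /P big_nat_recr.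
have US n : U n K.+1 = U n K * BI_u rho1 (rho2 n) r1 (r2 n) K.+1.
  by rewrite /U big_nat_recr.
have ratio := leadY_ratio hmu1 hmu2 hmu3 K D.
have rE : (leadY mu1 mu2 mu3 K.+1 D * (lowc mu2 K.+1 / 2)) ^+ 2
    = BI_u rho1 (rho2 (K + D.+1)%N) r1 (r2 (K + D.+1)%N) K.+1 * leadY mu1 mu2 mu3 K D.+1 ^+ 2.
  exact: ratio.
move: rE (IH D.+1); rewrite addSnnS PS US.
set a := leadY _ _ _ K.+1 D; set b := leadY _ _ _ K D.+1; set v := BI_u _ _ _ _ _ => rE E.
rewrite (_ : _ ^+ 2 = (a * (lowc mu2 K.+1 / 2)) ^+ 2 * P K ^+ 2); last by ring.
by rewrite rE mulrA -E; ring.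
Qed.

Lemma sphere_pt_circle (theta : R) :
  sphere_pt theta (pi / 2) = sphere_pt_alt (pi / 2) (pi / 2 - theta).
Proof.
rewrite /sphere_pt /sphere_pt_alt cos_pihalf sin_pihalf -opprB sinN cosN sinBpihalf cosBpihalf.
by rewrite mulr0 !mul1r mulr1 opprK.
Qed.

(** The angle pi / 2 is fixed by the reflection [pi - vtheta], so the parity distinction in Z
    disappears. *)
Lemma Zfun_equator N S (phi : R) :
  Zfun mu1 mu2 mu3 N S (pi / 2) phi = Yfun mu2 mu3 mu1 N S (pi / 2) phi.
Proof.
by rewrite /Zfun; case: odd => //; congr (Yfun _ _ _ _ _ _ _); field.
Qed.

Lemma Zfun_circle N S : exists f g : {poly R},
  (forall theta, Zfun mu1 mu2 mu3 N S (pi / 2) (pi / 2 - theta) = circle_fun N f g theta)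
  /\ (forall l, opX mu2 mu3 N (interleave f g) l
        = ((-1) ^+ S * (S%:R + mu2 + mu3 + 1 / 2)) * interleave f g l).
Proof.
have cZ b (f g : {poly R}) theta :
    circle_fun N (b *: f) (b *: g) theta = b * circle_fun N f g theta.
  by rewrite /circle_fun; case: odd; rewrite !hornerZ; ring.
have iZ b (f g : {poly R}) l : interleave (b *: f) (b *: g) l = b * interleave f g l.
  by rewrite /interleave; case: odd; rewrite coefZ.
have oZ b (f g : {poly R}) l : opX mu2 mu3 N (interleave (b *: f) (b *: g)) l
    = b * opX mu2 mu3 N (interleave f g) l.
  by rewrite /opX !iZ; case: l => [|l]; rewrite ?iZ; ring.
case oN: (odd N).
  set b := Ycoefm mu2 mu3 mu1 N S * jacobi (Yjacm mu2 mu3 mu1 N S).1.1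
    (Yjacm mu2 mu3 mu1 N S).1.2 (Yjacm mu2 mu3 mu1 N S).2 (-1).
  exists (b *: (Zm_poly mu2 mu3 S).1), (b *: (Zm_poly mu2 mu3 S).2); split.
    by move=> theta; rewrite Zfun_equator Yfun_equator oN cZ -Fm_circle.
  by move=> l; rewrite oZ iZ Zm_eigen// mulrCA.
set b := Ycoefp mu2 mu3 mu1 N S * jacobi (Yjacp mu2 mu3 mu1 N S).1.1
  (Yjacp mu2 mu3 mu1 N S).1.2 (Yjacp mu2 mu3 mu1 N S).2 (-1).
exists (b *: (Zp_poly mu2 mu3 S).1), (b *: (Zp_poly mu2 mu3 S).2); split.
  by move=> theta; rewrite Zfun_equator Yfun_equator oN cZ -Fp_circle.
by move=> l; rewrite oZ iZ Zp_eigen// mulrCA.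
Qed.

End Assembly.

Theorem mainTheorem4 (R : realType) (mu1 mu2 mu3 : R)
  (hmu1 : - (1 / 2) < mu1) (hmu2 : - (1 / 2) < mu2) (hmu3 : - (1 / 2) < mu3)
  (N : nat) (Rc : 'M[R]_(N.+1))
  (hRc : forall (S : 'I_N.+1) (theta phi vtheta vphi : R),
     sphere_pt theta phi = sphere_pt_alt vtheta vphi ->
     Zfun mu1 mu2 mu3 N S vtheta vphi
     = \sum_(K < N.+1) Rc S K * Yfun mu1 mu2 mu3 N K theta phi) :
  let mu := (-1) ^+ N * (N%:R + 1 + mu1 + mu2 + mu3) in
  let rho1 := (mu2 + mu3) / 2 in
  let rho2 := (mu1 + mu) / 2 in
  let r1 := (mu3 - mu2) / 2 in
  let r2 := (mu - mu1) / 2 in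
  let x (S : nat) : R := 1 / 2 * ((-1) ^+ S * (S%:R + mu2 + mu3 + 1 / 2) - 1 / 2) in
  forall S K : 'I_N.+1,
    Rc S K = Z_phase R N S
             * Num.sqrt (w_weight rho1 rho2 r1 r2 N S
                         / \prod_(1 <= i < K.+1) BI_u rho1 rho2 r1 r2 i)
             * (BI rho1 rho2 r1 r2 K).[x S].
Proof.
move=> mu rho1 rho2 r1 r2 x S K.
have [f [g [Zf Zeig]]] := Zfun_circle mu1 hmu2 hmu3 N S.
pose L (k : nat) := leadY mu1 mu2 mu3 k (N - k).
(* Coefficients with respect to [Yh], whose members start with s^k; the factor [L k] is the leading
   coefficient of Y_k. *)
pose r (k : nat) := Rc S (inord k) * L k.
have rK (k : 'I_N.+1) : r k = Rc S k * L k by rewrite /r inord_val.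
have Hz l : interleave f g l = \sum_(k < N.+1) r k * Yh mu1 mu2 mu3 N k l.
  rewrite (@circle_fun_sum_inj _ N N.+1 f g (fun k => Rc S k)
    (fun k => (Y_poly mu1 mu2 mu3 N k).1) (fun k => (Y_poly mu1 mu2 mu3 N k).2)).
    apply: eq_bigr => k _; rewrite rK -mulrA; congr (_ * _).
    have kN : (k <= N)%N by rewrite -ltnS.
    by have := Y_interleave hmu1 hmu2 hmu3 k (N - k) l; rewrite subnKC.
  move=> theta; rewrite -Zf (hRc S _ _ _ _ (sphere_pt_circle theta)).
  by apply: eq_bigr => k _; rewrite Yfun_circle.
have lamE : 2 * x S + 1 / 2 = (-1) ^+ S * (S%:R + mu2 + mu3 + 1 / 2).
  by rewrite /x; field.
have KN : (K <= N)%N by rewrite -ltnS.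
have SN : (S <= N)%N by rewrite -ltnS.
have Zeig' l : opX mu2 mu3 N (interleave f g) l = (2 * x S + 1 / 2) * interleave f g l.
  by rewrite lamE.
have main := connection_BI hmu1 hmu2 Zeig' Hz KN.
(* The coefficient of s^0 is the value at theta = 0, the north pole, where only [Yh 0]
   contributes. *)
have r0 : r 0 = north mu2 mu3 mu1 S (N - S).
  have := Hz 0; rewrite big_ord_recl Yh_diag mulr1 big1 ?addr0; last first.
    by move=> i _; rewrite Yh_lt ?mulr0.
  move=> <-; rewrite /north subnKC// -(Zfun_equator mu1 mu2 mu3).
  have := Zf 0; rewrite subr0 => ->.
  rewrite /circle_fun sin0 cos0 expr0n /= /interleave /= !horner_coef0.
  by case: odd; ring.
rewrite rK r0 in main.
have ph2 : Z_phase R N S * Z_phase R N S = 1.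
  by rewrite /Z_phase -exprD addnn -signr_odd odd_double.
have nE : north mu2 mu3 mu1 S (N - S)
    = Z_phase R N S * Num.sqrt (leadY mu1 mu2 mu3 0 N ^+ 2 * w_weight rho1 rho2 r1 r2 N S).
  have := weight_north hmu1 hmu2 hmu3 S (N - S); rewrite subnKC// => ->.
  have := north_gt0 hmu2 hmu3 hmu1 S (N - S); rewrite subnKC// => n0.
  set n := north _ _ _ _ _ in n0 *.
  rewrite -[n in LHS]mul1r -ph2 -mulrA; congr (_ * _).
  rewrite -[LHS]gtr0_norm// -sqrtr_sqr exprMn expr2 ph2 mul1r//.
have q0 := leadY_prod_gt0 hmu1 hmu2 hmu3 K (N - K).
have q2 := leadY_prod_sqr hmu1 hmu2 hmu3 K (N - K).
rewrite subnKC// in q2.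
have l0 : 0 < leadY mu1 mu2 mu3 0 N ^+ 2.
  rewrite exprn_even_gt0 //=; have := leadY_gt0 hmu1 hmu2 hmu3 0 N.
  by case: eqP => // ->; rewrite mulr0 ltxx.
have w0 : 0 <= w_weight rho1 rho2 r1 r2 N S.
  have := weight_north hmu1 hmu2 hmu3 S (N - S); rewrite subnKC// => wE.
  by rewrite -(pmulr_rge0 _ l0) wE exprn_even_ge0.
rewrite -/(L K) in q0 q2.
move: main q0 q2; rewrite -/rho1 -/rho2 -/r1 -/r2.
set q := L K * _; set u := \prod_(1 <= i < K.+1) BI_u _ _ _ _ i => main q0 q2.
(* The signs of u and w are read off from the square identities, which justifies splitting the
   square root of their quotient. *)
have u0 : 0 < u by rewrite -(pmulr_rgt0 _ l0) -q2 exprn_gt0.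
have qE : q = Num.sqrt (leadY mu1 mu2 mu3 0 N ^+ 2) * Num.sqrt u.
  by rewrite -sqrtrM ?ltW// -q2 sqrtr_sqr gtr0_norm.
have su0 : Num.sqrt u != 0 by rewrite sqrtr_eq0 -ltNge.
apply: (mulIf (lt0r_neq0 q0)).
rewrite [LHS](_ : _ = north mu2 mu3 mu1 S (N - S) * (BI rho1 rho2 r1 r2 K).[x S]); last first.
  by rewrite -main /q -?mulrA.
rewrite nE qE (sqrtrM _ (ltW l0)) (sqrtrM _ w0) (sqrtrV (ltW u0)).
by field; rewrite su0.
Qed.
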